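(* Let $p$ be a prime, let $F$ be the field with $p$ elements, let $\bar F$ be an algebraic closure of $F$, and let $G$ be a finite group. (a) The map $\Gamma:\mathrm{ITI}(\bar F G)\to\mathrm{ITI}(FG)$, defined for $Y\in\mathrm{ITI}(\bar F G)$ by $\Gamma(Y)=W\in\mathrm{ITI}(FG)$ if there is a $(K,V)\in\mathcal{E}(W)$ such that $V\otimes_K\bar F\cong Y$ as $\bar F G$-modules, is well-defined (that is, for each $Y$ there is exactly one such $W$). Moreover, if $\Gamma(Y)=W$, $(K,V)\in\mathcal{E}(W)$ satisfies $V\otimes_K\bar F\cong Y$, and $Q$ is a vertex of $W$, then $Q$ is a vertex of $V$ and of $Y$; and if $(Q,\mathscr{V})$ is a vertex-source pair of $V$, $(Q,\mathscr{Y})$ is a vertex-source pair of $Y$, and $H=N_G(Q)$, then $\mathscr{Y}^h\mid\mathscr{V}\otimes_K\bar F$ as $\bar F Q$-modules for some $h\in H$, and $\mathrm{Gr}_G^H(Y)\mid\mathrm{Gr}_G^H(V)\otimes_K\bar F$ as $\bar F H$-modules. (b) $\Gamma^{-1}(W)\neq\varnothing$ for all $W\in\mathrm{ITI}(FG)$. (c) $\mathrm{ITI}(\bar F G)=\bigcup_{W\in\mathrm{ITI}(FG)}\Gamma^{-1}(W)$ is a partition of $\mathrm{ITI}(\bar F G)$.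
   Context: All modules are finitely generated unitary right modules, and isomorphic modules are identified. For a subfield $K$ of $\bar F$, $\mathrm{ITI}(KG)$ denotes a set of representatives of the isomorphism types of indecomposable $KG$-modules. For modules $U,V$ over a ring, $U\mid V$ means that $U$ is isomorphic to a direct summand of $V$. For $W\in\mathrm{ITI}(FG)$ define $$\mathcal{E}(W)=\{(K,V)\mid K \text{ is a finite subfield of }\bar F,\ V\in\mathrm{ITI}(KG),\ V\mid W\otimes_F K \text{ as } KG\text{-modules}\}.$$ $\Gamma^{-1}(W)$ denotes the fibre $\{Y\in \mathrm{ITI}(\bar F G)\mid \Gamma(Y)=W\}$. A vertex-source pair $(Q,\mathscr{V})$ of an indecomposable $KG$-module $V$ consists of a vertex $Q$ of $V$ and an indecomposable $KQ$-module $\mathscr{V}$ that is a $Q$-source of $V$. For $h\in H=N_G(Q)$, $\mathscr{Y}^h$ is the conjugate of the $\bar F Q$-module $\mathscr{Y}$ by $h$, again an $\bar F Q$-module. For a subfield $K$ of $\bar F$, $\mathrm{Gr}_G^H$ denotes the Green correspondence from $G$ to $H=N_G(Q)$, sending an indecomposable $KG$-module with vertex $Q$ to its Green correspondent, an indecomposable $KH$-module with vertex $Q$. *)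

(* Defs.v *)
From HB Require Import structures.
From mathcomp Require Import all_boot all_algebra all_fingroup all_character.
From mathcomp Require Import classical_sets cardinality.

Set Implicit Arguments.
Unset Strict Implicit.
Unset Printing Implicit Defensive.

Import GRing.Theory GroupScope.
Local Open Scope ring_scope.
Local Open Scope classical_set_scope.

(* A finitely generated right KG-module is a packaged matrix representation
   [representation K G], acting on row vectors on the right; module isomorphism
   is [mx_rsim]. *)

Section Modules.

Variables (K : fieldType) (gT : finGroupType).

Definition iso_mod (G : {group gT}) (U V : representation K G) : Prop :=
  mx_rsim U V.

Definition summand (G : {group gT}) (U V : representation K G) : Prop :=
  exists U' : representation K G, iso_mod V (dadd_grepr U U').

Definition indecomposable (G : {group gT}) (V : representation K G) : Prop :=
  (0 < rdegree V)%N /\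
  forall U U' : representation K G, iso_mod V (dadd_grepr U U') ->
    rdegree U = 0%N \/ rdegree U' = 0%N.

Definition is_ITI (G : {group gT}) (S : set (representation K G)) : Prop :=
  (forall V, S V -> indecomposable V) /\
  (forall V, indecomposable V -> exists! U, S U /\ iso_mod V U).

Definition res_mod (G H : {group gT}) (sHG : H \subset G)
    (V : representation K G) : representation K H :=
  Representation (subg_repr V sHG).

Section Induction.

Variables (G H : {group gT}) (U : representation K H).

Definition transv (i : 'I_#|G : H|) : gT :=
  repr (@enum_val _ [pred A in rcosets H G] i).

(* The matrix of [g] on the induced module, the direct sum of the [U (x) t_i]
   with [t_i] running over representatives of the right cosets of [H]:
   [(u (x) t_i) g = u (t_i g t_j^-1) (x) t_j] for the only [j] such that
   [t_i g] lies in [H t_j]. *)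
Definition ind_mx (g : gT) : 'M[K]_(\sum_(i < #|G : H|) rdegree U) :=
  \mxblock_(i < #|G : H|, j < #|G : H|)
    (if (transv i * g * (transv j)^-1)%g \in H
     then U (transv i * g * (transv j)^-1)%g else 0).

Lemma transv_in i : H \subset G -> transv i \in G.
Proof.
move=> sHG; rewrite /transv; case/rcosetsP: (enum_valP i) => x Gx ->.
have := mem_repr x (rcoset_refl H x).
case/rcosetP=> y Hy ->; by rewrite groupM // (fintype.subsetP sHG).
Qed.

Lemma transvE i : H :* transv i = enum_val i :> {set gT}.
Proof.
rewrite /transv; case/rcosetsP: (enum_valP i) => x Gx ->.
by rewrite rcoset_repr.
Qed.

Lemma transv_inj i j :
  (transv i * (transv j)^-1)%g \in H -> i = j.
Proof.
rewrite -mem_rcoset => /rcoset_eqP e.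
by apply: enum_val_inj; rewrite -!transvE e.
Qed.

Lemma transv_surj x : x \in G -> exists i, (x * (transv i)^-1)%g \in H.
Proof.
move=> Gx; have cx : H :* x \in rcosets H G by apply/rcosetsP; exists x.
exists (enum_rank_in cx (H :* x)).
by rewrite -mem_rcoset transvE enum_rankK_in // rcoset_refl.
Qed.

Lemma ind_mx_repr : H \subset G -> mx_repr G ind_mx.
Proof.
move=> sHG; split=> [|g g' Gg Gg'].
  rewrite /ind_mx -mxdiagZ; apply: eq_mxblock => i j.
  rewrite mulg1; case: (eqVneq i j) => [<-|neq_ij].
    by rewrite mulgV group1 repr_mx1 conform_mx_id.
  by case: ifP => // /transv_inj eq_ij; rewrite eq_ij eqxx in neq_ij.
rewrite /ind_mx mul_mxblock; apply: eq_mxblock => i j.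
have Gi : (transv i * g)%g \in G by rewrite groupM ?transv_in.
have [k Hk] := transv_surj Gi.
rewrite (bigD1 k) //= Hk big1 ?addr0 => [|l neq_lk]; last first.
  case: ifP => [Hl|]; last by rewrite mul0mx.
  case/eqP: neq_lk; apply: transv_inj.
  by have := groupM (groupVr Hl) Hk; rewrite !invMg invgK !mulgA mulgKV mulgKV.
have -> : (transv i * (g * g') * (transv j)^-1 =
    (transv i * g * (transv k)^-1) * (transv k * g' * (transv j)^-1))%g.
  by rewrite !mulgA mulgKV.
rewrite groupMl //; case: ifP => [Hj|]; last by rewrite mulmx0.
exact: repr_mxM.
Qed.

Definition ind_mod (sHG : H \subset G) : representation K G :=
  Representation (MxRepresentation (ind_mx_repr sHG)).

End Induction.

Definition rel_projective (G : {group gT}) (V : representation K G)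
    (H : {group gT}) : Prop :=
  exists (sHG : H \subset G) (U : representation K H),
    summand V (ind_mod U sHG).

Definition vertex (G : {group gT}) (V : representation K G)
    (Q : {group gT}) : Prop :=
  rel_projective V Q /\
  forall R : {group gT}, R \subset Q -> rel_projective V R -> R = Q.

Definition vertex_source (G : {group gT}) (V : representation K G)
    (Q : {group gT}) (S : representation K Q) : Prop :=
  [/\ vertex V Q, indecomposable S &
      exists sQG : Q \subset G, summand V (ind_mod S sQG)].

(* [S^h], with [x] in [Q] acting as [h x h^-1] acts on [S]. *)
Definition conj_rep_mx (Q : {group gT}) (S : representation K Q) (h x : gT) :
    'M[K]_(rdegree S) := S (x ^ h^-1)%g.

Lemma conj_rep_mx_repr (Q : {group gT}) (S : representation K Q) (h : gT) :
  h \in 'N(Q) -> mx_repr Q (conj_rep_mx S h).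
Proof.
move=> Nh; rewrite /conj_rep_mx; split=> [|x y Qx Qy].
  by rewrite conj1g repr_mx1.
by rewrite conjMg repr_mxM // memJ_norm // groupV.
Qed.

Definition conj_mod (Q : {group gT}) (S : representation K Q) (h : gT)
    (Nh : h \in 'N(Q)) : representation K Q :=
  Representation (MxRepresentation (conj_rep_mx_repr S Nh)).

(* The graph of the Green correspondence [Gr_G^H] with [H = 'N_G(Q)]. *)
Definition Green (G Q : {group gT}) (V : representation K G)
    (U : representation K 'N_G(Q)) : Prop :=
  [/\ indecomposable V, vertex V Q, indecomposable U, vertex U Q
    & summand U (res_mod (subsetIl G 'N(Q)) V)].

End Modules.

Definition ext_mod (K L : fieldType) (f : {rmorphism K -> L})
    (gT : finGroupType) (G : {group gT}) (V : representation K G) :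
    representation L G :=
  Representation (map_repr f V).

(* The subfield [K] of [L] as a field in its own right; [divringClosed L] is
   the type of subfields of [L]. *)
Definition sub_field (L : fieldType) (K : divringClosed L) : Type :=
  {x : L | x \in K}.

Section SubField.

Variables (L : fieldType) (K : divringClosed L).

HB.instance Definition _ := SubType.on (sub_field K).
HB.instance Definition _ := [Choice of sub_field K by <:].
HB.instance Definition _ := [SubChoice_isSubUnitRing of sub_field K by <:].
HB.instance Definition _ :=
  [SubNzRing_isSubComNzRing of sub_field K by <:].
HB.instance Definition _ :=
  [SubComUnitRing_isSubIntegralDomain of sub_field K by <:].
HB.instance Definition _ :=
  [SubIntegralDomain_isSubField of sub_field K by <:].

Definition sub_incl : {rmorphism sub_field K -> L} := val.

Variables (p : nat) (iota : {rmorphism 'F_p -> L}).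

Lemma prime_field_sub (a : 'F_p) : iota a \in K.
Proof. by rewrite -[a]natr_Zp rmorph_nat rpred_nat. Qed.

Definition prime_incl_fun (a : 'F_p) : sub_field K :=
  exist _ (iota a) (prime_field_sub a).

Lemma prime_incl_is_zmod : zmod_morphism prime_incl_fun.
Proof. by move=> a b; apply: val_inj; rewrite /= rmorphB. Qed.

Lemma prime_incl_is_monoid : monoid_morphism prime_incl_fun.
Proof.
by split=> [|a b]; apply: val_inj; rewrite /= ?rmorph1 ?rmorphM.
Qed.

HB.instance Definition _ :=
  GRing.isZmodMorphism.Build 'F_p (sub_field K) prime_incl_fun
    prime_incl_is_zmod.
HB.instance Definition _ :=
  GRing.isMonoidMorphism.Build 'F_p (sub_field K) prime_incl_fun
    prime_incl_is_monoid.

Definition prime_incl : {rmorphism 'F_p -> sub_field K} := prime_incl_fun.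

End SubField.

Section GammaMap.

Variables (p : nat) (L : fieldType) (iota : {rmorphism 'F_p -> L}).
Variables (gT : finGroupType) (G : {group gT}).
Variable ITI : forall K : fieldType, set (representation K G).

(* [calE W] is a set of pairs [(K, V)], presented in curried form. *)
Definition calE (W : representation 'F_p G)
    (K : divringClosed L) (V : representation (sub_field K) G) : Prop :=
  [/\ finite_set [set x : L | x \in K], ITI V
    & summand V (ext_mod (prime_incl K iota) W)].

(* The graph of [Gamma]: [Gamma Y W] reads "Gamma(Y) = W". *)
Definition Gamma (Y : representation L G) (W : representation 'F_p G) : Prop :=
  exists (K : divringClosed L) (V : representation (sub_field K) G),
    calE W V /\ iso_mod (ext_mod (sub_incl K) V) Y.

Definition Gamma_fibre (W : representation 'F_p G) :
    set (representation L G) :=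
  [set Y | ITI Y /\ Gamma Y W].

End GammaMap.

(* Main.v *)
(** Let [W] be an indecomposable [FG]-module and [X] any [FG]-module. If [W] and
    [X] acquire a common nonzero summand [Y] after an extension of scalars to
    [E], then [W] is already a summand of [X]: otherwise all composites
    [W -> X -> W] lie in the radical of the local ring [End(W)], which is
    nilpotent and stays so over [E], while one of their [E]-combinations is the
    projection of [W] to [Y]. With [X] indecomposable this gives the uniqueness
    of [Gamma(Y)]; with [X = Ind_R^G Res_R W] it shows that [W] is
    [R]-projective as soon as [Y] is, so that [W], [V] and [Y] share their
    vertices.

    A module [Y] over the algebraic closure is defined over a finite subfield,
    and the sum of its Frobenius twists descends to [F]; hence [Y] is a summand
    of some [W] over the closure, and the splitting is again defined over a
    finite subfield [K].

    The statements on sources and Green correspondents come from Mackey's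
    formula, in the form of relative traces: in a local ring, if a sum of traces
    from the double cosets is invertible, then one of its terms is. *)

Require Import Defs.
From HB Require Import structures.
From mathcomp Require Import all_boot all_algebra all_fingroup all_character.
From mathcomp Require Import all_solvable all_field.
From mathcomp Require Import boolp classical_sets cardinality.

Set Implicit Arguments.
Unset Strict Implicit.
Unset Printing Implicit Defensive.

Import GRing.Theory GroupScope.
Local Open Scope ring_scope.
Local Open Scope classical_set_scope.

(** * Homomorphisms and direct summands *)

Section Homs.

Variables (K : fieldType) (gT : finGroupType) (G : {group gT}).
Implicit Types U V W : representation K G.

Definition hom U V (f : 'M[K]_(rdegree U, rdegree V)) : Prop :=
  forall g, g \in G -> U g *m f = f *m V g.

Arguments hom : clear implicits.

(** A direct summand given by its splitting maps. In this form it composes and survives restriction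
    and base change without a complement being named; [summandP] identifies it with [summand]. *)
Definition retract U V : Prop :=
  exists A B, [/\ hom U V A, hom V U B & A *m B = 1%:M].

Lemma hom1 U : hom U U 1%:M.
Proof. by move=> g _; rewrite mul1mx mulmx1. Qed.

Lemma hom0 U V : hom U V 0.
Proof. by move=> g _; rewrite mul0mx mulmx0. Qed.

Lemma homM U V W f g :
  hom U V f -> hom V W g ->
  hom U W (f *m g).
Proof. by move=> hf hg x Gx; rewrite mulmxA hf // -!mulmxA hg. Qed.

Lemma homD U V f g :
  hom U V f -> hom U V g ->
  hom U V (f + g).
Proof. by move=> hf hg x Gx; rewrite mulmxDr mulmxDl hf // hg. Qed.

Lemma homZ U V c f :
  hom U V f -> hom U V (c *: f).
Proof. by move=> hf x Gx; rewrite -scalemxAr -scalemxAl hf. Qed.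

Lemma homB U V f g :
  hom U V f -> hom U V g ->
  hom U V (f - g).
Proof.
by move=> hf hg; rewrite -scaleN1r; apply: homD => //; apply: homZ.
Qed.

Lemma hom_sum U V I (r : seq I) (P : pred I) F :
  (forall i, P i -> hom U V (F i)) ->
  hom U V (\sum_(i <- r | P i) F i).
Proof. by move=> hF; elim/big_ind: _ => //; [apply: hom0 | apply: homD]. Qed.

Lemma hom_inv U f :
  hom U U f -> hom U U (invmx f).
Proof.
move=> hf g Gg; have [fU|fN] := boolP (f \in unitmx); last first.
  by rewrite /invmx (negPf fN) hf.
by rewrite -[LHS](mulKmx fU) (mulmxA f) -hf // mulmxK.
Qed.

Lemma retract_refl U : retract U U.
Proof.
by exists 1%:M, 1%:M; split; rewrite ?mulmx1 //; apply: hom1.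
Qed.

Lemma retract_trans U V W : retract U V -> retract V W -> retract U W.
Proof.
move=> [A [B [hA hB AB]]] [A' [B' [hA' hB' AB']]].
exists (A *m A'), (B' *m B); split; [exact: homM hA hA'|exact: homM hB' hB|].
by rewrite mulmxA -(mulmxA A) AB' mulmx1.
Qed.

Lemma retract_deg U V : retract U V -> (rdegree U <= rdegree V)%N.
Proof.
case=> A [B [_ _ AB]]; rewrite -(mxrank1 K (rdegree U)) -AB.
exact: leq_trans (mxrankM_maxl _ _) (rank_leq_col _).
Qed.

Lemma retract_deg_iso U V :
  retract U V -> (rdegree V <= rdegree U)%N -> iso_mod U V.
Proof.
move=> rUV le; have le' := retract_deg rUV.
case: rUV => A [B [hA hB AB]].
exists A => //; first by apply/eqP; rewrite eqn_leq le' le.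
by apply/row_freeP; exists B.
Qed.

Lemma iso_retract U V : iso_mod U V -> retract U V.
Proof.
case=> B eqd fB hB; exists B, (pinvmx B); split=> //; last exact: mulmxVp.
have BK : pinvmx B *m B = 1%:M.
  by apply: mulVpmx; rewrite /row_full (eqP fB); apply/eqP.
move=> g Gg; rewrite -[V g]mul1mx -BK -(mulmxA _ B) -hB // -!mulmxA.
by rewrite mulmxVp // mulmx1.
Qed.

Lemma iso_mod_sym U V : iso_mod U V -> iso_mod V U.
Proof. exact: mx_rsim_sym. Qed.

Lemma iso_mod_trans U V W : iso_mod U V -> iso_mod V W -> iso_mod U W.
Proof. exact: mx_rsim_trans. Qed.

Section Image.

Variables (V : representation K G) (m : nat).
Variables (R : 'M[K]_(m, rdegree V)) (C : 'M[K]_(rdegree V, m)).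
Hypothesis RC : R *m C = 1%:M.
Hypothesis hCR : hom V V (C *m R).

Lemma image_mx_hom g : g \in G -> R *m V g *m C *m R = R *m V g.
Proof. by move=> Gg; rewrite -2!mulmxA hCR // !mulmxA RC mul1mx. Qed.

Lemma image_mx_repr : mx_repr G (fun g => R *m V g *m C).
Proof.
split=> [|g h Gg Gh]; first by rewrite repr_mx1 mulmx1.
by rewrite repr_mxM // !mulmxA image_mx_hom.
Qed.

(** The image of the idempotent endomorphism [C *m R] of [V], with the rows of [R] as basis. *)
Definition image_mod : representation K G :=
  Representation (MxRepresentation image_mx_repr).

Lemma hom_to_image : hom V image_mod C.
Proof.
by move=> g Gg /=; rewrite !mulmxA -hCR // -!mulmxA RC mulmx1.
Qed.

Lemma hom_of_image : hom image_mod V R.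
Proof. by move=> g Gg; apply: image_mx_hom. Qed.

End Image.

(** Idempotents split: in the rank factorization [e = C R], cancelling the outer full-rank factors
    of [C R C R = C R] leaves [R C = 1]. *)
Lemma idem_factor n (e : 'M[K]_n) : e *m e = e ->
  row_base e *m col_base e = 1%:M.
Proof.
move=> ee; have := mulmx_base e.
have /row_fullP[X] := col_base_full e.
have /row_freeP[Z] := row_base_free e.
move: (\rank e) (row_base e) (col_base e) X Z => r R C X Z RZ XC CR.
move: ee; rewrite -CR => /(congr1 (fun M => X *m M *m Z)).
by rewrite !mulmxA XC mul1mx -!mulmxA RZ !mulmx1.
Qed.

Lemma dadd_homs U V (X := dadd_grepr U V) :
  [/\ hom U X (row_mx 1%:M 0),
      hom V X (row_mx 0 1%:M),
      hom X U (col_mx 1%:M 0)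
    & hom X V (col_mx 0 1%:M)].
Proof.
split=> g _ /=; rewrite ?mul_mx_row ?mul_row_block ?mul_block_col ?mul_col_mx;
  by rewrite !(mulmx0, mul0mx) ?mulmx1 ?mul1mx ?(addr0, add0r).
Qed.

Lemma retract_daddl U V : retract U (dadd_grepr U V).
Proof.
have [hl _ hl' _] := dadd_homs U V.
exists (row_mx 1%:M 0), (col_mx 1%:M 0); split=> //.
by rewrite mul_row_col mulmx1 mulmx0 addr0.
Qed.

Lemma retract_daddr U V : retract V (dadd_grepr U V).
Proof.
have [_ hr _ hr'] := dadd_homs U V.
exists (row_mx 0 1%:M), (col_mx 0 1%:M); split=> //.
by rewrite mul_row_col mulmx1 mulmx0 add0r.
Qed.

(** The complement of a retract is the image of the idempotent [1 - B A]. *)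
Lemma summandP U V : summand U V <-> retract U V.
Proof.
split=> [[U' /iso_mod_sym/iso_retract rU]|[A [B [hA hB AB]]]].
  exact: retract_trans (retract_daddl U U') rU.
pose e := 1%:M - B *m A.
have BAe : B *m A *m e = 0.
  by rewrite mulmxBr mulmx1 !mulmxA -(mulmxA B) AB mulmx1 subrr.
have eBA : e *m (B *m A) = 0.
  by rewrite mulmxBl mul1mx !mulmxA -(mulmxA B) AB mulmx1 subrr.
have ee : e *m e = e by rewrite {1}/e mulmxBl mul1mx BAe subr0.
have he : hom V V e by apply: homB; [apply: hom1|apply: homM hB hA].
have := idem_factor ee; have := mulmx_base e.
move: (\rank e) (row_base e) (col_base e) => r R C CR RC.
have hCR : hom V V (C *m R) by rewrite CR.
exists (image_mod RC hCR).
have AC : A *m C = 0.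
  have -> : A *m C = A *m B *m (A *m (e *m C)).
    by rewrite AB mul1mx -CR -[in RHS]mulmxA RC mulmx1.
  by rewrite !mulmxA -2!(mulmxA A) BAe mulmx0 mul0mx.
have RB : R *m B = 0.
  have -> : R *m B = R *m e *m B *m (A *m B).
    by rewrite AB mulmx1 -CR !mulmxA RC mul1mx.
  by rewrite -!mulmxA (mulmxA B) (mulmxA e) eBA mul0mx mulmx0.
have MN : row_mx B C *m col_mx A R = 1%:M.
  by rewrite mul_row_col CR addrC subrK.
have NM : col_mx A R *m row_mx B C = 1%:M.
  by rewrite mul_col_row AB AC RB RC -scalar_mx_block.
exists (row_mx B C).
(* The two degrees agree because the identity of each size factors through the other. *)
- apply/eqP; rewrite eqn_leq; apply/andP; split.
    rewrite -{1}(mxrank1 K (rdegree V)) -MN.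
    exact: leq_trans (mxrankM_maxl _ _) (rank_leq_col _).
  rewrite -{1}(mxrank1 K (rdegree U + _)) -NM.
  exact: leq_trans (mxrankM_maxl _ _) (rank_leq_col _).
- by apply/row_freeP; exists (col_mx A R).
move=> g Gg /=; rewrite mul_mx_row mul_row_block !mulmx0 addr0 add0r hB //.
by congr row_mx; exact: (hom_to_image RC hCR).
Qed.

Lemma indec_idem V e : indecomposable V -> hom V V e ->
  e *m e = e -> e = 0 \/ e = 1%:M.
Proof.
move=> [_ indV] he ee; have RC := idem_factor ee; have CR := mulmx_base e.
have hCR : hom V V (col_base e *m row_base e) by rewrite CR.
have [] : summand (image_mod RC hCR) V.
  apply/summandP; exists (row_base e), (col_base e); split=> //.
    exact: hom_of_image.
  exact: hom_to_image.
move=> U' isoU'; case: (indV _ _ isoU') => /= d0.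
  by left; apply/eqP; rewrite -mxrank_eq0 d0.
(* The complement vanishes, so [e] has full rank, and an invertible idempotent is the identity. *)
right; case: isoU' => B /= eqd _ _.
have {eqd} : \rank e = rdegree V by move: eqd; rewrite d0 addn0.
move/eqP => /row_freeP[X eX]; rewrite -[LHS]mulmx1 -eX mulmxA.
by rewrite {1}ee.
Qed.

End Homs.

Arguments hom {K gT G} U V f.

(** * Local endomorphism rings *)

(* Write the characteristic polynomial of [a] as [q * 'X^k] with [q] prime to
   ['X]; the Bezout relation between [q] and ['X^(k+1)] gives [e]. *)
Lemma fitting_idem (K : fieldType) n (a : 'M[K]_n) :
  exists e : 'M_n, [/\ e *m e = e,
    forall b, b *m a = a *m b -> b *m e = e *m b,
    e = 1%:M -> a \in unitmx & e = 0 -> exists k, a ^+ k = 0].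
Proof.
case: n => [|n] in a *.
  exists 0; split; first by rewrite mul0mx.
  - by move=> b _; rewrite mulmx0 mul0mx.
  - by move=> _; rewrite unitmxE det_mx00 unitr1.
  by exists 1%N; apply: flatmx0.
have [k [q nr0 cpE]] := multiplicity_XsubC (char_poly a) 0.
rewrite monic_neq0 ?char_poly_monic //= polyC0 subr0 in nr0 cpE.
have cop : coprimep q ('X ^+ k.+1).
  by apply: coprimep_expr; rewrite -['X]subr0 -polyC0 coprimep_XsubC.
have [u [v uv1]] : exists u v : {poly K}, u * q + v * 'X^(k.+1) = 1.
  by case/Bezout_eq1_coprimepP: cop => -[u v] /= uv1; exists u, v.
pose e := horner_mx a (v * 'X^(k.+1) : {poly K}).
have e'E : 1%:M - e = horner_mx a (u * q : {poly K}).
  have := congr1 (horner_mx a) uv1; rewrite rmorphD rmorph1 /=.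
  by rewrite -[1%:M]/(1 : 'M_n.+1) => <-; rewrite addrK.
exists e; split.
- apply/eqP; rewrite eq_sym -subr_eq0 -{1}[e]mulmx1 -mulmxBr e'E /e.
  rewrite -[_ *m _]/(_ * _) -rmorphM /=.
  have -> : v * 'X^(k.+1) * (u * q) = v * 'X * u * (q * 'X ^+ k).
    by rewrite exprS !mulrA -!(mulrAC _ q) -!(mulrAC _ u).
  by rewrite -cpE rmorphM /= Cayley_Hamilton mulr0.
- by move=> b ba; apply: comm_mx_horner.
(* The exponent [k.+1] leaves a factor [a] in [e] even when [k = 0]. *)
- move=> e1; have : e = horner_mx a (v * 'X^k : {poly K}) *m a.
    by rewrite /e exprSr mulrA rmorphM /= horner_mx_X.
  by rewrite e1 => /esym/mulmx1_unit[].
move=> e0; exists k.+1; move: e'E; rewrite e0 subr0 => /esym uq1.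
have : horner_mx a (u * q * 'X^(k.+1) : {poly K}) = a ^+ k.+1.
  by rewrite rmorphM /= uq1 mul1r rmorphXn /= horner_mx_X.
have -> : u * q * 'X^(k.+1) = u * 'X * (q * 'X ^+ k).
  by rewrite exprS !mulrA -!(mulrAC _ q).
by rewrite -cpE rmorphM /= Cayley_Hamilton mulr0.
Qed.

Lemma unitmx_1Bnilp (K : fieldType) n (a : 'M[K]_n) k :
  a ^+ k = 0 -> 1%:M - a \in unitmx.
Proof.
move=> ak0; have := subrX1 a k; rewrite ak0 sub0r => /(congr1 -%R).
by rewrite opprK -mulNr opprB => /esym/mulmx1_unit[].
Qed.

Section LocalEnd.

Variables (K : fieldType) (gT : finGroupType) (G : {group gT}).
Variable V : representation K G.
Hypothesis indV : indecomposable V.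

(** The Fitting idempotent of [a] commutes with whatever commutes with [a], in particular with [G],
    so it is 0 or 1. *)
Lemma indec_unit_or_nilp a :
  hom V V a -> a \in unitmx \/ exists k, a ^+ k = 0.
Proof.
move=> ha; have [e [ee he e1 e0]] := fitting_idem a.
have : hom V V e by move=> g Gg; apply: he; apply: ha.
by move=> /(indec_idem indV)/(_ ee)[]; [right; apply: e0|left; apply: e1].
Qed.

Lemma nil_nonunit a k : a ^+ k = 0 :> 'M[K]_(rdegree V) -> a \notin unitmx.
Proof.
move=> ak0; apply/negP => aU.
have : a ^+ k \in unitmx.
  by elim: k {ak0} => [|k IH]; rewrite ?unitmx1 // exprS unitmx_mul aU.
rewrite ak0 unitmxE; case: (rdegree V) (proj1 indV) => // n _.
by rewrite det0 unitr0.
Qed.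

(** After division by [a + b] the two terms add up to 1; if the first is nilpotent, the second is 1
    minus a nilpotent. *)
Lemma local_unitD a b : hom V V a -> hom V V b ->
  a + b \in unitmx -> a \in unitmx \/ b \in unitmx.
Proof.
move=> ha hb abU; have hc := hom_inv (homD ha hb).
have [|[k ak0]] := indec_unit_or_nilp (homM hc ha).
  by rewrite unitmx_mul => /andP[_]; left.
right; have := unitmx_1Bnilp ak0; rewrite -(mulVmx abU) mulmxDr addrC addKr.
by rewrite unitmx_mul => /andP[].
Qed.

Lemma local_unit_sum (I : eqType) (r : seq I) F :
  (forall i, i \in r -> hom V V (F i)) ->
  \sum_(i <- r) F i \in unitmx -> exists2 i, i \in r & F i \in unitmx.
Proof.
elim: r => [|i r IH] hF.
  by rewrite big_nil => U0; have := @nil_nonunit 0 1%N (expr1 _); rewrite U0.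
have hFr j : j \in r -> hom V V (F j).
  by move=> rj; apply: hF; rewrite inE rj orbT.
rewrite big_cons => /local_unitD[].
- by apply: hF; apply: mem_head.
- by rewrite big_seq; apply: hom_sum => j; apply: hFr.
- by exists i => //; apply: mem_head.
by move=> /(IH hFr)[j rj FjU]; exists j; rewrite // inE rj orbT.
Qed.

End LocalEnd.

(** * Descent of common summands *)

Lemma ex_min_measure (T : Type) (P : T -> Prop) (m : T -> nat) :
  (exists x, P x) -> exists2 x, P x & forall y, P y -> (m x <= m y)%N.
Proof.
case=> x Px; have [k] := ubnP (m x); elim: k x Px => // k IH x Px lt_mk.
have [[y Py lt_yx]|no_y] := pselect (exists2 y, P y & (m y < m x)%N).
  by apply: (IH y Py); apply: leq_trans lt_yx _.
exists x => // y Py; rewrite leqNgt; apply/negP => lt_yx.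
by apply: no_y; exists y.
Qed.

Lemma ex_max_rank (K : fieldType) n (P : 'M[K]_n -> Prop) :
  (exists Z, P Z) ->
  exists2 Z, P Z & forall Z', P Z' -> (\rank Z' <= \rank Z)%N.
Proof.
case/(ex_min_measure (fun Z => n - \rank Z)%N) => Z PZ Zmin; exists Z => // Z'.
by move/Zmin; rewrite leq_sub2lE // rank_leq_col.
Qed.

(** A matrix of maximal rank with row space inside [J] spans [J], since adjoining a vector of [J]
    cannot raise the rank. *)
Lemma subspace_mx (K : fieldType) n (J : 'rV[K]_n -> Prop) :
  J 0 -> (forall c u v, J u -> J v -> J (c *: u + v)) ->
  exists M : 'M[K]_n, forall u, J u <-> (u <= M)%MS.
Proof.
move=> J0 JD.
have [|M JM Mmax] := @ex_max_rank K n (fun M => forall u, (u <= M)%MS -> J u).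
  by exists 0 => u; rewrite submx0 => /eqP->.
exists M => u; split=> [Ju|]; last exact: JM.
have /Mmax le_rank : forall v, (v <= M + u)%MS -> J v.
  move=> v /sub_addsmxP[[w c] ->] /=; rewrite addrC [c]mx11_scalar mul_scalar_mx.
  by apply: JD => //; apply: JM; apply: submxMl.
apply: submx_trans (addsmxSr M u) _.
by rewrite -(geq_leqif (mxrank_leqif_sup (addsmxSl M u))).
Qed.

Section NilIdem.

Variables (F E : fieldType) (f : {rmorphism F -> E}) (n : nat).
Variable J : 'M[F]_n -> Prop.
Hypotheses (J0 : J 0) (JD : forall c a b, J a -> J b -> J (c *: a + b)).
Hypothesis JM : forall a b, J a -> J b -> J (a *m b).
Hypothesis J_nil : forall a, J a -> 1%:M - a \in unitmx.

(* A vector outside [Z] for which [x J + Z] has minimal dimension does the job: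
   if [y = x a] were outside [Z], minimality would give [y = y b + z] with [b]
   in [J] and [z] in [Z], and [1 - b] is invertible. *)
Lemma nil_space_kernel (Z : 'M[F]_n) :
  (forall a, J a -> (Z *m a <= Z)%MS) -> ~~ row_full Z ->
  exists2 x : 'rV_n, ~~ (x <= Z)%MS & forall a, J a -> (x *m a <= Z)%MS.
Proof.
move=> ZJ nfZ.
(* With matrices flattened to rows, [Jm] spans [J] and [Jm *m lin_mul_row x] spans [x J]. *)
have [||Jm JmP] := @subspace_mx F (n * n) (fun u => J (vec_mx u)).
- by rewrite linear0.
- by move=> c u v Ju Jv; rewrite linearP; apply: JD.
have JP a : J a <-> (mxvec a <= Jm)%MS by rewrite -JmP mxvecK.
have [|x xZ xmin] := @ex_min_measure 'rV[F]_n (fun x => ~~ (x <= Z)%MS)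
  (fun x => \rank (Jm *m lin_mul_row x + Z)%MS).
  by move: nfZ; rewrite -sub1mx => /row_subPn[i ?]; exists (row i 1%:M).
exists x => // a Ja; apply/negPn/negP => yZ; have le_xy := xmin _ yZ.
case/negP: (yZ).
set y := x *m a in yZ le_xy *.
have sub_yx : (Jm *m lin_mul_row y + Z <= Jm *m lin_mul_row x + Z)%MS.
  apply: addsmxS => //; apply/row_subP => i.
  rewrite row_mul -[row i Jm]vec_mxK mul_vec_lin_row /y -mulmxA.
  rewrite -[x *m _](mul_vec_lin_row (a *m vec_mx (row i Jm))).
  apply: submxMr; apply/JP; apply: JM => //; apply/JP.
  by rewrite vec_mxK row_sub.
have : (y <= Jm *m lin_mul_row y + Z)%MS.
  apply: (@submx_trans _ _ _ _ _ _ (Jm *m lin_mul_row x + Z)%MS).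
    apply: submx_trans (addsmxSl _ _).
    by rewrite -[y](mul_vec_lin_row a); apply: submxMr; apply/JP.
  by rewrite -(geq_leqif (mxrank_leqif_sup sub_yx)).
case/sub_addsmxP => -[u v] /= yE.
pose b := vec_mx (u *m Jm); have Jb : J b by apply/JmP; apply: submxMl.
have b1 : 1%:M - b \in unitmx by apply: J_nil.
have yb : y *m (1%:M - b) = v *m Z.
  rewrite mulmxBr mulmx1 {1}yE mulmxA -[u *m Jm]vec_mxK mul_vec_lin_row.
  by rewrite addrC addKr.
rewrite -[y](mulmxK b1) yb -mulmxA.
apply: submx_trans (submxMl _ _) _.
(* [Z] is stable under the invertible [1 - b], hence by dimension also under its inverse. *)
have sub1 : (Z *m (1%:M - b) <= Z)%MS.
  by rewrite mulmxBr mulmx1 addmx_sub // eqmx_opp; apply: ZJ.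
have sub2 : (Z <= Z *m (1%:M - b))%MS.
  by rewrite -(geq_leqif (mxrank_leqif_sup sub1)) mxrankMfree // row_free_unit.
by apply: submx_trans (submxMr _ sub2) _; rewrite mulmxK.
Qed.

(** The [E]-span of [J] contains no idempotent but 0. Take [Z] maximal among the [J]-stable spaces
    over [F] that [e] kills. Were [Z] proper, some [x] outside it would satisfy [x J <= Z]; then
    [x e] lies in the extension of [Z], so [x e = x e e = 0], and [Z + x] contradicts maximality. *)
Lemma nil_span_idem (I : finType) (c : I -> E) (b : I -> 'M[F]_n) :
  let e := \sum_i c i *: map_mx f (b i) in
  (forall i, J (b i)) -> e *m e = e -> e = 0.
Proof.
move=> e Jb ee.
pose P (Z : 'M_n) :=
  (forall a, J a -> (Z *m a <= Z)%MS) /\ (map_mx f Z <= kermx e)%MS.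
have [|Z [ZJ Ze] Zmax] := @ex_max_rank F n P.
  by exists 0; split=> [a _|]; rewrite ?mul0mx ?map_mx0 sub0mx.
have [|nfZ] := boolP (row_full Z).
  rewrite -sub1mx -(map_submx f) map_mx1 => /submx_trans/(_ Ze).
  by rewrite sub_kermx mul1mx => /eqP.
have [x xZ xJ] := nil_space_kernel ZJ nfZ.
case/negP: xZ; have /Zmax le_rank : P (Z + x)%MS.
  split=> [a Ja|].
    by rewrite addsmxMr; apply: submx_trans (addsmxSl _ _);
       rewrite addsmx_sub ZJ //= xJ.
  rewrite map_addsmx addsmx_sub Ze sub_kermx -ee mulmxA -sub_kermx.
  rewrite mulmx_sumr summx_sub // => i _.
  rewrite -scalemxAr scalemx_sub // -map_mxM.
  by apply: submx_trans Ze; rewrite map_submx xJ.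
apply: submx_trans (addsmxSr Z x) _.
by rewrite -(geq_leqif (mxrank_leqif_sup (addsmxSl Z x))).
Qed.

End NilIdem.

Section Extension.

Variables (F E : fieldType) (f : {rmorphism F -> E}).
Variables (gT : finGroupType) (G : {group gT}).
Implicit Types U V W X : representation F G.

Lemma hom_ext U V a :
  hom U V a -> hom (ext_mod f U) (ext_mod f V) (map_mx f a).
Proof. by move=> ha g Gg; rewrite /= /map_repr_mx -!map_mxM ha. Qed.

Lemma retract_ext U V : retract U V -> retract (ext_mod f U) (ext_mod f V).
Proof.
case=> A [B [hA hB AB]]; exists (map_mx f A), (map_mx f B).
by split; [apply: hom_ext|apply: hom_ext|rewrite -map_mxM AB map_mx1].
Qed.

(* Being a homomorphism is a system of linear equations over [F]. *)
Lemma hom_ext_span U V a : hom (ext_mod f U) (ext_mod f V) a ->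
  exists (I : finType) (c : I -> E) (b : I -> 'M_(_, _)),
    (forall i, hom U V (b i)) /\ a = \sum_i c i *: map_mx f (b i).
Proof.
move=> ha; pose m := rdegree U; pose n := rdegree V.
pose D g : 'M_(m * n) := lin_mulmx (U g) - lin_mulmxr (V g).
have DE g (x : 'M_(m, n)) : mxvec x *m D g = mxvec (U g *m x - x *m V g).
  by rewrite mulmxBr !mul_vec_lin /= linearB.
have DfE g (x : 'M[E]_(m, n)) : mxvec x *m map_mx f (D g) =
    mxvec (map_mx f (U g) *m x - x *m map_mx f (V g)).
  rewrite map_mxB mulmxBr linearB /=; congr (_ - _).
    rewrite (@map_lin_mx _ _ f _ _ _ _ _ (mulmx (map_mx f (U g)))).
      by rewrite mul_vec_lin.
    by move=> A; rewrite map_mxM.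
  rewrite (@map_lin_mx _ _ f _ _ _ _ _ (mulmxr (map_mx f (V g)))).
    by rewrite mul_vec_lin.
  by move=> A; rewrite /= map_mxM.
(* [B] is the intersection of the kernels of the [D g]; kernels and intersections commute with
   [map_mx f], so the extension of [B] contains all solutions over [E]. *)
have [B [BP BfP]] : exists B : 'M_(m * n),
    (forall u : 'rV_(m * n),
       (u <= B)%MS -> forall g, g \in G -> u *m D g = 0) /\
    (forall u : 'rV_(m * n), (forall g, g \in G -> u *m map_mx f (D g) = 0) ->
       (u <= map_mx f B)%MS).
  have [B [BP BfP]] : exists B : 'M_(m * n),
    (forall u : 'rV_(m * n),
       (u <= B)%MS -> forall g, g \in enum G -> u *m D g = 0) /\
    (forall u : 'rV_(m * n),
      (forall g, g \in enum G -> u *m map_mx f (D g) = 0) ->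
       (u <= map_mx f B)%MS).
    elim: (enum G) => [|g s [B [BP BfP]]].
      by exists 1%:M; split=> // u _; rewrite map_mx1 submx1.
    exists (B :&: kermx (D g))%MS; split=> u.
      rewrite sub_capmx => /andP[uB uD] h; rewrite inE => /predU1P[->|].
        by apply/eqP; rewrite -sub_kermx.
      exact: BP.
    move=> us; rewrite map_capmx sub_capmx map_kermx sub_kermx.
    rewrite us ?mem_head // eqxx andbT; apply: BfP => h sh.
    by apply: us; rewrite inE sh orbT.
  exists B; split=> [u uB g Gg|u uG]; first by apply: BP; rewrite ?mem_enum.
  by apply: BfP => g; rewrite mem_enum; apply: uG.
have /submxP[w wE] : (mxvec a <= map_mx f B)%MS.
  by apply: BfP => g Gg; rewrite DfE [map_mx f (U g) *m _]ha // subrr linear0.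
exists 'I_(m * n), (fun i => w 0 i), (fun i => vec_mx (row i B)); split.
  move=> i g Gg; apply/eqP; rewrite -subr_eq0 -(can_eq mxvecK) linear0 -DE.
  by rewrite vec_mxK BP ?row_sub.
rewrite -[a]mxvecK wE mulmx_sum_row linear_sum /=; apply: eq_bigr => i _.
by rewrite linearZ /= -map_row map_vec_mx.
Qed.

(* If [W] is not a summand of [X], the endomorphisms of [W] that factor through
   [X] lie in the radical of its local endomorphism ring. The radical is
   nilpotent, and stays so after extending the scalars, so it cannot contain
   the projection of [W] to [Y]. *)
Lemma retract_descent W X (Y : representation E G) :
  indecomposable W -> (0 < rdegree Y)%N ->
  retract Y (ext_mod f W) -> retract Y (ext_mod f X) -> retract W X.
Proof.
move=> indW Ygt0 [i [pi [hi hpi ipi]]] [j [rho [hj hrho jrho]]].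
apply: contrapT => notWX.
have rad al be : hom W X al -> hom X W be -> al *m be \notin unitmx.
  move=> hal hbe; apply/negP => U; apply: notWX.
  exists al, (be *m invmx (al *m be)); split=> //.
    exact: homM hbe (hom_inv (homM hal hbe)).
  by rewrite mulmxA mulmxV.
have [I [c [al [hal alE]]]] := hom_ext_span (homM hpi hj).
have [I' [d [be [hbe beE]]]] := hom_ext_span (homM hrho hi).
pose J a := hom W W a /\ a \notin unitmx.
have eE : (pi *m j) *m (rho *m i) = pi *m i.
  by rewrite mulmxA -(mulmxA pi) jrho mulmx1.
have ee : (pi *m i) *m (pi *m i) = pi *m i.
  by rewrite mulmxA -(mulmxA pi) ipi mulmx1.
have e_sum : pi *m i = \sum_(k : I * I') (c k.1 * d k.2) *:
    map_mx f (al k.1 *m be k.2).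
  rewrite -eE alE beE mulmx_suml.
  under eq_bigr do rewrite mulmx_sumr.
  rewrite pair_big /=; apply: eq_bigr => k _.
  by rewrite -scalemxAl -scalemxAr scalerA map_mxM.
have e0 : pi *m i = 0.
  rewrite e_sum; apply: (@nil_span_idem F E f _ J) => //; last by rewrite -e_sum.
  - split; first exact: hom0.
    by apply: (@nil_nonunit _ _ _ _ indW _ 1%N); rewrite expr1.
  - move=> x a b [ha na] [hb nb]; split; first by apply: homD => //; apply: homZ.
    apply/negP => /(local_unitD indW (homZ x ha) hb)[|]; last by apply/negP.
    by rewrite -mul_scalar_mx unitmx_mul (negPf na) andbF.
  - move=> a b [ha na] [hb nb]; split; first exact: homM ha hb.
    by rewrite unitmx_mul (negPf na).
  - move=> a [ha na]; have [|[k]] := indec_unit_or_nilp indW ha.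
      by rewrite (negPf na).
    exact: unitmx_1Bnilp.
  by move=> k; split; [apply: homM (hal _) (hbe _)|apply: rad].
have : i *m (pi *m i) *m pi = 0 by rewrite e0 mulmx0 mul0mx.
rewrite mulmxA ipi mul1mx ipi => /(congr1 (@mxrank _ _ _)).
by rewrite mxrank1 mxrank0 => Y0; rewrite Y0 in Ygt0.
Qed.

End Extension.

(** * Sums over cosets and relative traces *)

Section CosetSums.

Local Open Scope group_scope.

Variables (gT : finGroupType) (A : nmodType).
Implicit Types (G H Q R : {group gT}) (phi : gT -> A).

(** Under [linv] this is the sum of a function on the right cosets of [Q], independent of
    representatives. Transitivity and Mackey's formula for traces are instances of regrouping such
    sums. *)
Definition csum Q G phi : A := \sum_(C in rcosets Q G) phi (repr C).

Definition linv Q G phi : Prop :=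
  forall q x, q \in Q -> x \in G -> phi (q * x)%g = phi x.

Lemma rcosets_repr Q G C : Q \subset G -> C \in rcosets Q G ->
  repr C \in G /\ Q :* repr C = C.
Proof.
move=> sQG /rcosetsP[x Gx ->]; rewrite rcoset_repr; split=> //.
have /rcosetP[q Qq ->] := mem_repr x (rcoset_refl Q x).
by rewrite groupM // (fintype.subsetP sQG).
Qed.

Lemma linv_repr Q G phi x :
  linv Q G phi -> x \in G -> phi (repr (Q :* x)) = phi x.
Proof.
move=> hphi Gx; have /rcosetP[q Qq ->] := mem_repr x (rcoset_refl Q x).
exact: hphi.
Qed.

Lemma eq_csum Q G phi psi : Q \subset G ->
  {in G, phi =1 psi} -> csum Q G phi = csum Q G psi.
Proof.
move=> sQG eq_phi; apply: eq_bigr => C /(rcosets_repr sQG)[Gr _].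
exact: eq_phi.
Qed.

Lemma csum_ord Q G phi :
  csum Q G phi = \sum_(i < #|G : Q|) phi (transv i).
Proof.
rewrite /csum (@big_enum_val _ _ _ _ (mem (rcosets Q G)) (phi \o repr)).
by apply: eq_bigr.
Qed.

Lemma csum_id Q phi : csum Q Q phi = phi 1%g.
Proof. by rewrite /csum rcosets_id big_set1 repr_group. Qed.

(** The cosets of [Q] inside a coset [H y] are the translates by [y] of the cosets of [Q] in [H]. *)
Lemma csum_trans Q H G phi : Q \subset H -> H \subset G -> linv Q G phi ->
  csum Q G phi = csum H G (fun x => csum Q H (fun s => phi (s * x)%g)).
Proof.
move=> sQH sHG hphi; have sQG := fintype.subset_trans sQH sHG.
rewrite /csum (partition_big (fun C : {set gT} => (H * C)%g)
  (mem (rcosets H G))) /=; last first.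
  move=> C /rcosetsP[x Gx ->]; rewrite mulgA mulGSid //.
  by apply/rcosetsP; exists x.
apply: eq_bigr => D HD; have [Gy Dy] := rcosets_repr sHG HD.
move: (repr D) Gy Dy HD => y Gy <- HD.
pose h (C : {set gT}) := Q :* (repr C * y).
have hG C : C \in rcosets Q H -> repr C * y \in G.
  case/(rcosets_repr sQH) => Hr _.
  by rewrite groupM // (fintype.subsetP sHG).
have hinj : {in rcosets Q H &, injective h}.
  move=> C C' /(rcosets_repr sQH)[_ CE] /(rcosets_repr sQH)[_ C'E].
  by rewrite /h !rcosetM => /rcoset_inj; rewrite CE C'E.
transitivity (\sum_(C in h @: rcosets Q H) phi (repr C)).
  apply: eq_bigl => C; apply/andP/imsetP => [[/rcosetsP[x Gx ->] /eqP eHx]|].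
    have : x \in H :* y.
      by rewrite -eHx mulgA mulGSid // rcoset_refl.
    case/rcosetP => s Hs xE; exists (Q :* s); first by apply/rcosetsP; exists s.
    by rewrite /h rcosetM rcoset_repr -rcosetM -xE.
  case=> C' QC' ->; split.
    by apply/rcosetsP; exists (repr C' * y)%g => //; apply: hG.
  rewrite mulgA mulGSid // rcosetM rcoset_id //.
  by case/(rcosets_repr sQH): QC'.
rewrite big_imset //; apply: eq_bigr => C QC.
by apply: (linv_repr hphi); apply: hG.
Qed.

(** [s] lists representatives of the double cosets [Q y H]; the cosets of [Q] in [Q y H] are the
    [Q y h], with [h] running over [H] modulo [H :&: Q :^ y]. *)
Lemma csum_Mackey Q H G phi : Q \subset G -> H \subset G -> linv Q G phi ->
  exists s : seq gT, {subset s <= G} /\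
    csum Q G phi =
      \sum_(x <- s) csum (H :&: Q :^ x)%G H (fun h => phi (x * h)%g).
Proof.
move=> sQG sHG hphi.
pose Bs := (fun C : {set gT} => C * H) @: rcosets Q G.
have BsP B : B \in Bs -> repr B \in G /\ Q :* repr B * H = B.
  case/imsetP => C /rcosetsP[x Gx ->] ->.
  have : repr (Q :* x * H) \in Q :* x * H.
    by apply: (@mem_repr _ _ x); rewrite -{1}[x]mulg1 mem_mulg ?rcoset_refl.
  case/mulsgP => z h /rcosetP[q Qq ->] Hh ->; split.
    by rewrite !groupM // ?(fintype.subsetP sQG q) ?(fintype.subsetP sHG).
  by rewrite !rcosetM (rcoset_id Qq) -mulgA (lcoset_id Hh).
exists [seq repr B | B <- enum Bs]; split.
  by move=> x /mapP[B]; rewrite mem_enum => /BsP[Gr _] ->.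
rewrite big_map big_enum /= /csum.
rewrite (partition_big (fun C : {set gT} => (C * H)%g) (mem Bs)) /=; last first.
  by move=> C QC; apply: imset_f.
apply: eq_bigr => B /BsP[]; move: (repr B) => y Gy <- {B}.
pose R := (H :&: Q :^ y)%G; pose h (D : {set gT}) := Q :* (y * repr D).
have sRH : R \subset H by apply: subsetIl.
have hG D : D \in rcosets R H -> y * repr D \in G.
  case/(rcosets_repr sRH) => Hr _.
  by rewrite groupM // (fintype.subsetP sHG).
have hinj : {in rcosets R H &, injective h}.
  move=> D D' /(rcosets_repr sRH)[Hr DE] /(rcosets_repr sRH)[Hr' D'E] /esym hDD'.
  rewrite -DE -D'E; apply: rcoset_eqP; rewrite mem_rcoset inE groupM ?groupV //=.
  have : y * repr D \in Q :* (y * repr D').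
    by rewrite -[Q :* _]/(h D') hDD' rcoset_refl.
  by rewrite mem_rcoset mem_conjg conjgE !invMg invgK !mulgA.
transitivity (\sum_(C in h @: rcosets R H) phi (repr C)).
  apply: eq_bigl => C; apply/andP/imsetP => [[/rcosetsP[x Gx ->] /eqP eHx]|].
    have : x \in Q :* y * H.
      by rewrite -eHx -{1}[x]mulg1 mem_mulg ?rcoset_refl.
    case/mulsgP => z k /rcosetP[q Qq ->] Hk xE; exists (R :* k).
      by apply/rcosetsP; exists k.
    have /rcosetP[r /setIP[_ Qyr] rE] := mem_repr k (rcoset_refl R k).
    rewrite /h rE xE -mulgA rcosetM (rcoset_id Qq); apply/esym/rcoset_eqP.
    rewrite mem_rcoset; move: Qyr; rewrite mem_conjg conjgE.
    by rewrite !invMg invgK !mulgA !mulgK.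
  case=> D RD ->; split.
    by apply/rcosetsP; exists (y * repr D)%g => //; apply: hG.
  rewrite /h rcosetM -mulgA; have [Hr _] := rcosets_repr sRH RD.
  by rewrite (lcoset_id Hr).
rewrite big_imset //; apply: eq_bigr => D RD.
by apply: (linv_repr hphi); apply: hG.
Qed.

End CosetSums.

Lemma csum_translate (gT : finGroupType) (A : nmodType) (Q G : {group gT})
    (phi : gT -> A) g :
  Q \subset G -> linv Q G phi -> g \in G ->
  csum Q G (fun x => phi (x * g)%g) = csum Q G phi.
Proof.
move=> sQG hphi Gg; rewrite [RHS]/csum.
rewrite (reindex_inj (can_inj (rcosetK g))) /=; apply: eq_big => C.
  apply/idP/idP => [/rcosetsP[x Gx ->]|/rcosetsP[x Gx eC]].
    by apply/rcosetsP; exists (x * g)%g; rewrite ?groupM // rcosetM.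
  apply/rcosetsP; exists (x * g^-1)%g; first by rewrite groupM ?groupV.
  by rewrite rcosetM -eC rcosetK.
case/(rcosets_repr sQG) => Gr CE.
by rewrite -{2}CE -rcosetM (linv_repr hphi) // groupM.
Qed.

Section RelativeTrace.

Variables (K : fieldType) (gT : finGroupType).

(** In other words, [phi (x * h)] is [phi x] conjugated by [N h]. As translation by [h] permutes the
    cosets, the coset sum is then an endomorphism of [N]. *)
Definition equivar (G H : {group gT}) (N : representation K H)
    (phi : gT -> 'M[K]_(rdegree N)) : Prop :=
  forall x h, x \in G -> h \in H -> N h *m phi (x * h)%g = phi x *m N h.

Lemma csum_hom (Q G H : {group gT}) (N : representation K H) phi :
  Q \subset G -> H \subset G -> linv Q G phi -> equivar G phi ->
  hom N N (csum Q G phi).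
Proof.
move=> sQG sHG hphi ephi h Hh; have Gh := fintype.subsetP sHG h Hh.
rewrite -{1}(csum_translate sQG hphi Gh) /csum mulmx_sumr mulmx_suml.
by apply: eq_bigr => C /(rcosets_repr sQG)[Gr _]; apply: ephi.
Qed.

Definition conj_mx (G : {group gT}) (V : representation K G)
    (al : 'M[K]_(rdegree V)) (x : gT) : 'M[K]_(rdegree V) :=
  V x^-1%g *m al *m V x.

Arguments conj_mx [G] V al x.

(** Higman's relative trace from [H]-endomorphisms to [G]-endomorphisms. *)
Definition reltr (H G : {group gT}) (V : representation K G) al :=
  csum H G (conj_mx V al).

Arguments reltr H [G] V al.

Section Trace.

Variables (G H : {group gT}) (sHG : H \subset G) (V : representation K G).
Implicit Types (al : 'M[K]_(rdegree V)).

Lemma conj_mx_linv al : hom (res_mod sHG V) (res_mod sHG V) al ->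
  linv H G (conj_mx V al).
Proof.
move=> hal h x Hh Gx; have Gh := fintype.subsetP sHG h Hh.
rewrite /conj_mx invMg !repr_mxM ?groupV // -!mulmxA; congr (_ *m _).
have := hal h^-1%g; rewrite groupV => /(_ Hh) /= E.
by rewrite !mulmxA E -(mulmxA al) -repr_mxM ?groupV // mulVg repr_mx1 mulmx1.
Qed.

Lemma conj_mx_equivar al : equivar G (conj_mx V al).
Proof.
move=> x g Gx Gg; rewrite /conj_mx invMg !repr_mxM ?groupM ?groupV // !mulmxA.
by rewrite -repr_mxM ?groupV // mulgV repr_mx1 mul1mx.
Qed.

Lemma reltr_hom al :
  hom (res_mod sHG V) (res_mod sHG V) al -> hom V V (reltr H V al).
Proof.
by move=> hal; apply: csum_hom => //; [apply: conj_mx_linv|apply: conj_mx_equivar].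
Qed.

Lemma reltrD al be : reltr H V (al + be) = reltr H V al + reltr H V be.
Proof.
rewrite /reltr /csum -big_split; apply: eq_bigr => C _ /=.
by rewrite /conj_mx mulmxDr mulmxDl.
Qed.

Lemma reltrMr al c : hom V V c -> reltr H V (al *m c) = reltr H V al *m c.
Proof.
move=> hc; rewrite /reltr /csum mulmx_suml; apply: eq_bigr => C.
case/(rcosets_repr sHG) => Gr _.
by rewrite /conj_mx -!mulmxA (hc _ Gr).
Qed.

End Trace.

Lemma reltr_trans (G H Q : {group gT}) (sHG : H \subset G) (sQH : Q \subset H)
    (sQG : Q \subset G) (V : representation K G) al :
  hom (res_mod sQG V) (res_mod sQG V) al ->
  reltr Q V al = reltr H V (reltr Q (res_mod sHG V) al).
Proof.
move=> hal; rewrite /reltr (csum_trans sQH sHG (conj_mx_linv hal)).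
apply: eq_csum => // x Gx; rewrite /conj_mx /csum mulmx_sumr mulmx_suml.
apply: eq_bigr => C /(rcosets_repr sQH)[Hr _] /=.
have Gr := fintype.subsetP sHG _ Hr.
by rewrite invMg !repr_mxM ?groupV // !mulmxA.
Qed.

Section Frobenius.

Variables (G H : {group gT}) (sHG : H \subset G).
Variables (V : representation K G) (U : representation K H).

(** One half of Frobenius reciprocity. In block column [j] of [ind_mx g] a single block is nonzero,
    the one whose representative lies in the coset of [transv j * g^-1]. *)
Lemma hom_to_ind f : hom (res_mod sHG V) U f ->
  hom V (ind_mod U sHG) (\mxrow_(j < #|G : H|) (V (transv j)^-1%g *m f)).
Proof.
move=> hf g Gg /=; rewrite /ind_mx mul_mxrow mul_mxrow_mxblock.
apply: eq_mxrow => j.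
have Gj : (transv j * g^-1)%g \in G by rewrite groupM ?groupV ?(transv_in _ sHG).
have [i Hi] := transv_surj H Gj.
have Hi' : (transv i * g * (transv j)^-1)%g \in H.
  by move: Hi; rewrite -groupV !invMg !invgK mulgA.
rewrite (bigD1 i) //= Hi' big1 ?addr0 => [|k neq_ki]; last first.
  case: ifP => [Hk|]; last by rewrite mulmx0.
  case/eqP: neq_ki; apply: transv_inj.
  by have := groupM Hk (groupVr Hi'); rewrite !invMg invgK !mulgA mulgKV mulgK.
rewrite -mulmxA -(hf _ Hi') /= !mulmxA.
rewrite -!repr_mxM ?groupM ?groupV ?(transv_in _ sHG) //.
by rewrite !mulgA mulVg mul1g.
Qed.

Lemma hom_of_ind f : hom U (res_mod sHG V) f ->
  hom (ind_mod U sHG) V (\mxcol_(i < #|G : H|) (f *m V (transv i))).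
Proof.
move=> hf g Gg /=; rewrite /ind_mx mxcol_mul mul_mxblock_mxrow.
apply: eq_mxcol => i.
have Gi : (transv i * g)%g \in G by rewrite groupM ?(transv_in _ sHG).
have [j Hj] := transv_surj H Gi.
rewrite (bigD1 j) //= Hj big1 ?addr0 => [|k neq_kj]; last first.
  case: ifP => [Hk|]; last by rewrite mul0mx.
  case/eqP: neq_kj; apply: transv_inj.
  by have := groupM (groupVr Hk) Hj; rewrite !invMg invgK !mulgA mulgKV mulgKV.
rewrite mulmxA (hf _ Hj) /= -!mulmxA.
rewrite -!repr_mxM ?groupM ?groupV ?(transv_in _ sHG) //.
by rewrite mulgKV.
Qed.

(** This links summands of induced modules to relative traces. *)
Lemma ind_comp (f : 'M_(rdegree V, rdegree U)) (g : 'M_(rdegree U, rdegree V)) :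
  (\mxrow_(j < #|G : H|) (V (transv j)^-1%g *m f)) *m
  (\mxcol_(i < #|G : H|) (g *m V (transv i))) = reltr H V (f *m g).
Proof.
rewrite mul_mxrow_mxcol /reltr csum_ord; apply: eq_bigr => i _.
by rewrite /conj_mx !mulmxA.
Qed.

End Frobenius.

(* [a x] and [b x] are the components of the two maps at the translate
   [X (x) x] of [X] inside the induced module, for any [x] in [G] rather than
   for the chosen coset representatives only. *)
Lemma ind_components (G H Q : {group gT}) (sHG : H \subset G)
    (sQG : Q \subset G) (N : representation K H) (X : representation K Q) :
  retract N (res_mod sHG (ind_mod X sQG)) ->
  exists (a : gT -> 'M[K]_(rdegree N, rdegree X))
         (b : gT -> 'M[K]_(rdegree X, rdegree N)),
    [/\ forall q x, q \in Q -> x \in G -> a (q * x)%g *m X q = a x,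
        forall q x, q \in Q -> x \in G -> b (q * x)%g = X q *m b x,
        forall x h, x \in G -> h \in H -> N h *m a (x * h)%g = a x,
        forall x h, x \in G -> h \in H -> b (x * h)%g = b x *m N h
      & csum Q G (fun x => a x *m b x) = 1%:M].
Proof.
case=> A [B [hA hB AB]].
pose Aj j := submxrow A j; pose Bj j := submxcol B j.
have AE : A = \mxrow_j Aj j by rewrite submxrowK.
have BE : B = \mxcol_j Bj j by rewrite submxcolK.
pose t := @transv gT G Q; have Gt i : t i \in G by apply: transv_in.
have tinj i j x : (x * (t i)^-1)%g \in Q -> (x * (t j)^-1)%g \in Q -> i = j.
  move=> Qi Qj; apply: transv_inj.
  by have := groupM (groupVr Qi) Qj; rewrite invMg invgK mulgA mulgKV.
(* For [x = q t_j] with [q] in [Q], the only surviving terms are [A_j q^-1] in [a x] and [q B_j] in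
   [b x]. *)
pose a x := \sum_j (if (x * (t j)^-1)%g \in Q
                    then Aj j *m X (t j * x^-1)%g else 0).
pose b x := \sum_j (if (x * (t j)^-1)%g \in Q
                    then X (x * (t j)^-1)%g *m Bj j else 0).
have aE x j : (x * (t j)^-1)%g \in Q -> a x = Aj j *m X (t j * x^-1)%g.
  move=> Qj; rewrite /a (bigD1 j) //= Qj big1 ?addr0 // => k /eqP neq.
  by case: ifP => // Qk; case: neq; apply: tinj Qj.
have bE x j : (x * (t j)^-1)%g \in Q -> b x = X (x * (t j)^-1)%g *m Bj j.
  move=> Qj; rewrite /b (bigD1 j) //= Qj big1 ?addr0 // => k /eqP neq.
  by case: ifP => // Qk; case: neq; apply: tinj Qj.
have AN h i j : h \in H -> (t i * h * (t j)^-1)%g \in Q ->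
    N h *m Aj j = Aj i *m X (t i * h * (t j)^-1)%g.
  move=> Hh Qij; have := hA h Hh; rewrite AE /= mul_mxrow /ind_mx.
  rewrite mul_mxrow_mxblock => /eq_mxrowP/(_ j) ->.
  rewrite (bigD1 i) //= Qij big1 ?addr0 // => k /eqP neq.
  case: ifP => [Qk|]; last by rewrite mulmx0.
  case: neq; apply: transv_inj.
  by have := groupM Qk (groupVr Qij); rewrite !invMg invgK !mulgA mulgKV mulgK.
have BN h i j : h \in H -> (t i * h * (t j)^-1)%g \in Q ->
    X (t i * h * (t j)^-1)%g *m Bj j = Bj i *m N h.
  move=> Hh Qij; have := hB h Hh; rewrite BE /= mxcol_mul /ind_mx.
  rewrite mul_mxblock_mxrow => /eq_mxcolP/(_ i) <-.
  rewrite (bigD1 j) //= Qij big1 ?addr0 // => k /eqP neq.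
  case: ifP => [Qk|]; last by rewrite mul0mx.
  case: neq; apply: transv_inj.
  by have := groupM (groupVr Qk) Qij; rewrite !invMg invgK !mulgA mulgKV mulgKV.
have Qswap x i : (x * (t i)^-1)%g \in Q -> (t i * x^-1)%g \in Q.
  by rewrite -groupV invMg invgK.
exists a, b; split.
- move=> q x Qq Gx; have [j Qj] := transv_surj Q Gx.
  have Qqj : (q * x * (t j)^-1)%g \in Q by rewrite -mulgA groupM.
  rewrite (aE _ _ Qj) (aE _ _ Qqj) -mulmxA -repr_mxM //; last exact: Qswap.
  by rewrite invMg !mulgA mulgKV.
- move=> q x Qq Gx; have [j Qj] := transv_surj Q Gx.
  have Qqj : (q * x * (t j)^-1)%g \in Q by rewrite -mulgA groupM.
  by rewrite (bE _ _ Qj) (bE _ _ Qqj) mulmxA -repr_mxM // mulgA.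
- move=> x h Gx Hh; have [i Qi] := transv_surj Q Gx.
  have Gxh : (x * h)%g \in G by rewrite groupM // (fintype.subsetP sHG).
  have [j Qj] := transv_surj Q Gxh.
  have Qij : (t i * h * (t j)^-1)%g \in Q.
    by have := groupM (Qswap _ _ Qi) Qj; rewrite !mulgA mulgKV.
  rewrite (aE _ _ Qi) (aE _ _ Qj) mulmxA (AN h i j) // -mulmxA -repr_mxM //.
    by rewrite invMg !mulgA mulgKV mulgK.
  exact: Qswap.
- move=> x h Gx Hh; have [i Qi] := transv_surj Q Gx.
  have Gxh : (x * h)%g \in G by rewrite groupM // (fintype.subsetP sHG).
  have [j Qj] := transv_surj Q Gxh.
  have Qij : (t i * h * (t j)^-1)%g \in Q.
    by have := groupM (Qswap _ _ Qi) Qj; rewrite !mulgA mulgKV.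
  rewrite (bE _ _ Qi) (bE _ _ Qj) -mulmxA -(BN h i j) // mulmxA -repr_mxM //.
  by rewrite !mulgA mulgKV.
rewrite csum_ord -AB AE BE mul_mxrow_mxcol; apply: eq_bigr => i _.
have Qi : (t i * (t i)^-1)%g \in Q by rewrite mulgV.
by rewrite (aE _ _ Qi) (bE _ _ Qi) mulgV !repr_mx1 mulmx1 mul1mx.
Qed.

(** Higman's criterion. A splitting is recovered from its components at 1, because those at [x] are
    their translates by [V x]. *)
Lemma ind_retractP (G H : {group gT}) (sHG : H \subset G)
    (V : representation K G) (U : representation K H) :
  retract V (ind_mod U sHG) <->
  exists f g, [/\ hom (res_mod sHG V) U f, hom U (res_mod sHG V) g
                & reltr H V (f *m g) = 1%:M].
Proof.
split=> [rVU|[f [g [hf hg tr1]]]]; last first.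
  exists (\mxrow_(j < #|G : H|) (V (transv j)^-1%g *m f)).
  exists (\mxcol_(i < #|G : H|) (g *m V (transv i))).
  by split; [apply: hom_to_ind|apply: hom_of_ind|rewrite ind_comp].
have [|a [b [aQ bQ aG bG ab]]] :=
  @ind_components G G H (fintype.subxx G) sHG V U.
  case: rVU => A [B [hA hB AB]]; exists A, B.
  split; [exact: hA | exact: hB | exact: AB].
have a1 x : x \in G -> a x = V x^-1%g *m a 1%g.
  move=> Gx; rewrite -(aG 1%g x) // mul1g mulmxA -repr_mxM ?groupV //.
  by rewrite mulVg repr_mx1 mul1mx.
have b1 x : x \in G -> b x = b 1%g *m V x.
  by move=> Gx; rewrite -bG // mul1g.
exists (a 1%g), (b 1%g); split=> [h Hh /=|h Hh /=|].
- have Gh := fintype.subsetP sHG h Hh.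
  rewrite -{1}(aQ h 1%g) // mulg1 (a1 h) // !mulmxA -repr_mxM ?groupV //.
  by rewrite mulgV repr_mx1 mul1mx.
- by have Gh := fintype.subsetP sHG h Hh; rewrite -bQ // mulg1 b1.
rewrite -ab /reltr; apply: (eq_csum sHG) => x Gx.
by rewrite /conj_mx (a1 x) // (b1 x) // !mulmxA.
Qed.

Lemma rel_projectiveP (G : {group gT}) (V : representation K G)
    (H : {group gT}) :
  rel_projective V H <->
  exists (sHG : H \subset G) al,
    hom (res_mod sHG V) (res_mod sHG V) al /\ reltr H V al = 1%:M.
Proof.
split=> [[sHG [U /summandP/ind_retractP[f [g [hf hg tr1]]]]]|].
  by exists sHG, (f *m g); split=> //; apply: homM hf hg.
case=> sHG [al [hal tr1]]; exists sHG, (res_mod sHG V).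
apply/summandP/ind_retractP; exists al, 1%:M; split=> //; first exact: hom1.
by rewrite mulmx1.
Qed.

(** The trace is linear over [G]-endomorphisms, so an invertible trace can be normalized to 1. *)
Lemma rel_projective_unit (G H : {group gT}) (sHG : H \subset G)
    (V : representation K G) al :
  hom (res_mod sHG V) (res_mod sHG V) al -> reltr H V al \in unitmx ->
  rel_projective V H.
Proof.
move=> hal U; apply/rel_projectiveP; exists sHG.
have hi := hom_inv (reltr_hom hal).
exists (al *m invmx (reltr H V al)); split.
  by apply: homM hal _ => h Hh; apply: hi; apply: (fintype.subsetP sHG).
by rewrite (reltrMr sHG) // mulmxV.
Qed.

(** A trace-one endomorphism of [S], put between the splitting maps and traced in stages, gives one
    of [V]. *)
Lemma rel_projective_ind (G Q R : {group gT}) (sQG : Q \subset G)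
    (V : representation K G) (S : representation K Q) :
  retract V (ind_mod S sQG) -> rel_projective S R -> rel_projective V R.
Proof.
case/ind_retractP => f [g [hf hg tr1]] /rel_projectiveP[sRQ [be [hbe tr2]]].
apply/rel_projectiveP; have sRG := fintype.subset_trans sRQ sQG; exists sRG.
have hal : hom (res_mod sRG V) (res_mod sRG V) (f *m be *m g).
  move=> r Rr /=; have Qr := fintype.subsetP sRQ r Rr.
  have /= hfr := hf _ Qr; have /= hgr := hg _ Qr; have /= hbr := hbe _ Rr.
  by rewrite !mulmxA hfr -(mulmxA f) hbr -!mulmxA hgr !mulmxA.
exists (f *m be *m g); split=> //.
rewrite (reltr_trans sQG sRQ hal) -[RHS]tr1; congr (reltr _ _ _).
transitivity (f *m reltr R S be *m g); last by rewrite tr2 mulmx1.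
rewrite /reltr /csum mulmx_sumr mulmx_suml; apply: eq_bigr => C.
case/(rcosets_repr sRQ) => Qr _; rewrite /conj_mx /=.
have /= hgr := hg _ Qr; have Qr' := groupVr Qr; have /= hfr := hf _ Qr'.
by rewrite !mulmxA hfr -!mulmxA hgr.
Qed.

(** The step shared by the results on sources and on Green correspondents: one of the double coset
    traces is a unit, and [c] is its inverse. *)
Lemma mackey_local (G H Q : {group gT}) (N : representation K H) phi :
  Q \subset G -> H \subset G -> indecomposable N ->
  linv Q G phi -> equivar (N := N) G phi -> csum Q G phi \in unitmx ->
  exists2 x, x \in G & exists c, [/\ hom N N c,
    rel_projective N (H :&: Q :^ x)%G
    & reltr (H :&: Q :^ x)%G N (phi x *m c) = 1%:M].
Proof.
move=> sQG sHG indN hphi ephi.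
have [s [sG ->]] := csum_Mackey sQG sHG hphi.
pose R x := (H :&: Q :^ x)%G.
have sRH x : R x \subset H by apply: subsetIl.
(* For [r] in [H :&: Q :^ x], write [x r = (x r x^-1) x] with left factor in [Q]: so
   [phi (x r) = phi x], and equivariance makes [phi x] commute with [r]. *)
have hR x : x \in G -> hom (res_mod (sRH x) N) (res_mod (sRH x) N) (phi x).
  move=> Gx r /[dup] Rr /setIP[Hr]; rewrite mem_conjg conjgE invgK => Qr /=.
  by rewrite -(ephi x r) // -(hphi _ x Qr) // !mulgA mulgKV.
have trE x : x \in G ->
    csum (R x) H (fun h => phi (x * h)%g) = reltr (R x) N (phi x).
  move=> Gx; apply: eq_csum => // h Hh.
  rewrite /conj_mx -mulmxA -ephi // mulmxA -repr_mxM ?groupV //.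
  by rewrite mulVg repr_mx1 mul1mx.
case/(local_unit_sum indN) => [x /sG Gx|x /sG Gx].
  by rewrite trE //; apply: reltr_hom; apply: hR.
rewrite trE // => trU; exists x => //.
exists (invmx (reltr (R x) N (phi x))); split.
- by apply: hom_inv; apply: reltr_hom; apply: hR.
- by apply: rel_projective_unit trU; apply: hR.
rewrite (reltrMr (sRH x)) ?mulmxV //.
by apply: hom_inv; apply: reltr_hom; apply: hR.
Qed.

End RelativeTrace.

Arguments conj_mx {K gT G} V al x.
Arguments reltr {K gT} H {G} V al.

(** * Indecomposable summands and sources *)

Section IndecSummand.

Variables (K : fieldType) (gT : finGroupType) (G : {group gT}).
Implicit Types U V X : representation K G.

Lemma iso_dadd_split X U V : iso_mod X (dadd_grepr U V) ->
  exists p1 i1 p2 i2, [/\ hom X U p1, hom U X i1, hom X V p2, hom V X i2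
    & p1 *m i1 + p2 *m i2 = 1%:M].
Proof.
case/iso_retract => A [B [hA hB AB]]; have [hl hr hl' hr'] := dadd_homs U V.
exists (A *m col_mx 1%:M 0), (row_mx 1%:M 0 *m B).
exists (A *m col_mx 0 1%:M), (row_mx 0 1%:M *m B).
split; [exact: homM hA hl'|exact: homM hl hB|exact: homM hA hr'
       |exact: homM hr hB|].
rewrite !mulmxA -mulmxDl -!(mulmxA A) -mulmxDr -[RHS]AB -[A in RHS]mulmx1;
  congr (A *m _ *m B).
rewrite !mul_col_row !(mulmx1, mul1mx) !(mulmx0, mul0mx) add_block_mx.
by rewrite !(addr0, add0r) -scalar_mx_block.
Qed.

(** Induction on the degree: a property that one of any two complementary summands inherits descends
    to an indecomposable summand. *)
Lemma indec_summand_such (P : representation K G -> Prop) X :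
  (forall X, P X -> (0 < rdegree X)%N) ->
  (forall X U V, iso_mod X (dadd_grepr U V) -> P X -> P U \/ P V) ->
  P X -> exists L, [/\ indecomposable L, retract L X & P L].
Proof.
move=> Pgt0 Pdadd; have [m] := ubnP (rdegree X); elim: m X => // m IH X le_m PX.
have [indX|] := pselect (indecomposable X).
  by exists X; split=> //; apply: retract_refl.
move=> /not_andP[|]; first by rewrite Pgt0.
move=> /existsNP[U /existsNP[V /not_implyP[isoX /not_orP[/eqP U0 /eqP V0]]]].
have degX : rdegree X = (rdegree U + rdegree V)%N := mxrank_rsim isoX.
have smaller Z : (rdegree Z < rdegree X)%N -> retract Z X -> P Z ->
    exists L, [/\ indecomposable L, retract L X & P L].
  move=> ltZ rZ /IH[|L [indL rL PL]]; first exact: leq_trans ltZ _.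
  by exists L; split=> //; apply: retract_trans rZ.
case: (Pdadd _ _ _ isoX PX); apply: smaller.
- by rewrite degX -addn1 leq_add2l lt0n.
- by apply/summandP; exists V.
- by rewrite degX addnC -addn1 leq_add2l lt0n.
apply: retract_trans (retract_daddr U V) _.
by apply: iso_retract; apply: iso_mod_sym.
Qed.

Lemma retract_indec_iso U V :
  retract U V -> indecomposable V -> (0 < rdegree U)%N -> iso_mod U V.
Proof.
move=> rUV [_ indV] Ugt0; have /summandP[U' isoV] := rUV.
case: (indV _ _ isoV) => U0; first by rewrite U0 in Ugt0.
apply: (retract_deg_iso rUV).
by rewrite (mxrank_rsim isoV) /= U0 addn0.
Qed.

Lemma iso_of_eq n (rU rV : mx_representation K G n) :
  (forall g, g \in G -> rU g = rV g) ->
  iso_mod (Representation rU) (Representation rV).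
Proof.
move=> eqUV; exists 1%:M => //=; first by rewrite row_free_unit unitmx1.
by move=> g Gg; rewrite mulmx1 mul1mx eqUV.
Qed.

Lemma retract_of_eq n (rU rV : mx_representation K G n) :
  (forall g, g \in G -> rU g = rV g) ->
  retract (Representation rU) (Representation rV).
Proof. by move=> eqUV; apply: iso_retract; apply: iso_of_eq. Qed.

End IndecSummand.

(** If [X] splits, the trace-one equation of [V] becomes a sum of two traces, one for each part. One
    of them is a unit, and [V] divides the module induced from that part. *)
Lemma indec_ind_summand (K : fieldType) (gT : finGroupType)
    (G H : {group gT}) (sHG : H \subset G) (V : representation K G)
    (X : representation K H) :
  indecomposable V -> retract V (ind_mod X sHG) ->
  exists L, [/\ indecomposable L, retract L X & retract V (ind_mod L sHG)].
Proof.
move=> indV.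
apply: (indec_summand_such (P := fun X => retract V (ind_mod X sHG))).
  move=> {}X /retract_deg /=; rewrite sum_nat_const; case: (rdegree X) => //.
  by rewrite muln0 leqn0 => /eqP V0; case: indV; rewrite V0.
move=> {}X U W /iso_dadd_split[p1 [i1 [p2 [i2 [hp1 hi1 hp2 hi2 pi1]]]]].
case/ind_retractP => f [g [hf hg tr1]].
have part (Z : representation K H) (p : 'M_(rdegree X, rdegree Z)) i :
    hom X Z p -> hom Z X i -> reltr H V (f *m p *m (i *m g)) \in unitmx ->
    retract V (ind_mod Z sHG).
  move=> hp hi trU; have hfp := homM hf hp; have hig := homM hi hg.
  pose u := invmx (reltr H V (f *m p *m (i *m g))).
  have hu : hom V V u := hom_inv (reltr_hom (homM hfp hig)).
  apply/ind_retractP; exists (f *m p), (i *m g *m u); split=> //.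
    apply: homM hig _ => h Hh; apply: hu; exact: (fintype.subsetP sHG).
  rewrite mulmxA; exact: etrans (reltrMr sHG _ hu) (mulmxV trU).
have : reltr H V (f *m p1 *m (i1 *m g)) + reltr H V (f *m p2 *m (i2 *m g))
    \in unitmx.
  rewrite -reltrD -2!(mulmxA f) -mulmxDr !(mulmxA _ _ g) -mulmxDl pi1 mul1mx.
  by rewrite tr1 unitmx1.
case/(local_unitD indV).
- exact: reltr_hom (homM (homM hf hp1) (homM hi1 hg)).
- exact: reltr_hom (homM (homM hf hp2) (homM hi2 hg)).
- by move=> trU; left; apply: part trU.
by move=> trU; right; apply: part trU.
Qed.

Section Sources.

Variables (K : fieldType) (gT : finGroupType).

Lemma reltr_id (G : {group gT}) (V : representation K G) al :
  reltr G V al = al.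
Proof.
by rewrite /reltr csum_id /conj_mx invg1 repr_mx1 mul1mx mulmx1.
Qed.

(** Minimality turns the [Q :&: Q :^ x] of [mackey_local] into [Q]. Hence [x] normalizes [Q], the
    trace is the identity map, and [a x], [b x *m c] split [S] off the conjugate of [X]. *)
Lemma mackey_source (G Q : {group gT}) (sQG : Q \subset G)
    (S X : representation K Q) :
  indecomposable S ->
  (forall R : {group gT}, R \subset Q -> rel_projective S R -> R = Q) ->
  retract S (res_mod sQG (ind_mod X sQG)) ->
  exists (x : gT) (Nx : x \in 'N(Q)), x \in G /\ retract S (conj_mod X Nx).
Proof.
move=> indS minS /ind_components[a [b [aQ bQ aG bG ab1]]].
pose phi x := a x *m b x.
have hphi : linv Q G phi.
  by move=> q x Qq Gx; rewrite /phi bQ // mulmxA aQ.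
have ephi : equivar (N := S) G phi.
  by move=> x q Gx Qq; rewrite /phi mulmxA aG // bG // mulmxA.
have phiU : csum Q G phi \in unitmx by rewrite ab1 unitmx1.
have [x Gx [c [hc relR tr1]]] := mackey_local sQG sQG indS hphi ephi phiU.
have RQ := minS _ (subsetIl _ _) relR.
move: tr1; rewrite RQ reltr_id => xc1.
have Nx : x \in 'N(Q).
  have sQQx : Q \subset Q :^ x by rewrite -{1}RQ subsetIr.
  rewrite inE; have : Q :==: Q :^ x by rewrite eqEcard sQQx cardJg /=.
  by move/eqP <-.
exists x, Nx; split=> //; exists (a x), (b x *m c).
have Qx q : q \in Q -> (q ^ x^-1)%g \in Q by rewrite memJ_norm // groupV.
have Gxq q : q \in Q -> (x * q^-1)%g \in G.
  by move=> Qq; rewrite groupM ?groupV // (fintype.subsetP sQG).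
have xq q : (q ^ x^-1 * (x * q^-1) = x)%g.
  by rewrite conjgE invgK !mulgA mulgKV mulgK.
split=> [q Qq /=|q Qq /=|]; last by rewrite mulmxA.
  rewrite /conj_rep_mx -{1}[x](mulgKV q) aG ?Gxq //.
  by rewrite -(aQ _ _ (Qx q Qq)) ?xq ?Gxq.
rewrite /conj_rep_mx -mulmxA -hc // !mulmxA; congr (_ *m _).
by rewrite -bG // -bQ ?Qx // conjgE invgK !mulgA mulgKV.
Qed.

(** [S] is isomorphic to [S1^x] because [S1] is indecomposable, so [S1^(x y^-1)] is isomorphic to
    [S^(y^-1)], which divides [S2]. *)
Lemma conj_mod_retract (Q : {group gT}) (S S1 S2 : representation K Q)
    (x y : gT) (Nx : x \in 'N(Q)) (Ny : y \in 'N(Q))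
    (Nxy : (x * y^-1)%g \in 'N(Q)) :
  indecomposable S -> indecomposable S1 ->
  retract S (conj_mod S1 Nx) -> retract S (conj_mod S2 Ny) ->
  retract (conj_mod S1 Nxy) S2.
Proof.
move=> [S_gt0 _] indS1 rS1 [A2 [B2 [hA2 hB2 AB2]]].
have Nx' : x^-1%g \in 'N(Q) by rewrite groupV.
have rS' : retract (conj_mod S Nx') S1.
  case: rS1 => A1 [B1 [hA1 hB1 AB1]]; exists A1, B1; split=> //= q Qq.
    rewrite /= /conj_rep_mx invgK hA1 ?memJ_norm //= /conj_rep_mx.
    by rewrite -conjgM mulgV conjg1.
  rewrite /= /conj_rep_mx invgK -hB1 ?memJ_norm //= /conj_rep_mx.
  by rewrite -conjgM mulgV conjg1.
have [A [B [hA hB AB]]] :=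
  iso_retract (iso_mod_sym (retract_indec_iso rS' indS1 S_gt0)).
have Qqy q : q \in Q -> (q ^ y)%g \in Q by move=> Qq; rewrite memJ_norm.
have Qqyx q : q \in Q -> (q ^ (y * x^-1))%g \in Q.
  by move=> Qq; rewrite memJ_norm // groupM ?groupV.
exists (A *m A2), (B2 *m B); split=> [q Qq|q Qq|] /=.
- rewrite /conj_rep_mx invMg invgK mulmxA.
  have := hA _ (Qqyx q Qq); rewrite /= /conj_rep_mx invgK -conjgM mulgKV => ->.
  have := hA2 _ (Qqy q Qq); rewrite /= /conj_rep_mx -conjgM mulgV conjg1.
  by rewrite -!mulmxA => ->.
- rewrite /conj_rep_mx invMg invgK -mulmxA.
  have := hB _ (Qqyx q Qq); rewrite /= /conj_rep_mx invgK -conjgM mulgKV => <-.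
  have := hB2 _ (Qqy q Qq); rewrite /= /conj_rep_mx -conjgM mulgV conjg1.
  by rewrite !mulmxA => ->.
by rewrite mulmxA -(mulmxA A) AB2 mulmx1.
Qed.

(** Conjugacy of sources, with an arbitrary [X] since it will be the extension of a source over a
    smaller field. Both [S] and [X] are compared with a source [T] that divides [Res V]. *)
Lemma source_conj (G Q : {group gT}) (sQG : Q \subset G)
    (V : representation K G) (S X : representation K Q) :
  indecomposable V -> vertex V Q -> indecomposable S ->
  retract V (ind_mod S sQG) -> retract V (ind_mod X sQG) ->
  exists (h : gT) (Nh : h \in 'N(Q)),
    h \in 'N_G(Q) /\ retract (conj_mod S Nh) X.
Proof.
move=> indV [relQ minQ] indS rS rX.
have [T [indT rT rVT]] : exists T, [/\ indecomposable T,
    retract T (res_mod sQG V) & retract V (ind_mod T sQG)].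
  apply: indec_ind_summand => //.
  have /rel_projectiveP[sQG' [al [hal tr1]]] := relQ.
  apply/ind_retractP; exists al, 1%:M.
  by split; [exact: hal|exact: hom1|rewrite mulmx1].
have minT (R : {group gT}) : R \subset Q -> rel_projective T R -> R = Q.
  by move=> sRQ relR; apply: minQ => //; apply: rel_projective_ind rVT relR.
have rres Z : retract V (ind_mod Z sQG) ->
    retract T (res_mod sQG (ind_mod Z sQG)).
  case=> A [B [hA hB AB]]; apply: retract_trans rT _; exists A, B.
  by split=> // q Qq; [apply: hA|apply: hB]; apply: (fintype.subsetP sQG).
have [x [Nx [Gx rTS]]] := mackey_source indT minT (rres _ rS).
have [y [Ny [Gy rTX]]] := mackey_source indT minT (rres _ rX).
have Nxy : (x * y^-1)%g \in 'N(Q) by rewrite groupM ?groupV.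
exists (x * y^-1)%g, Nxy; split; last exact: conj_mod_retract rTS rTX.
by rewrite inE Nxy andbT groupM ?groupV.
Qed.

End Sources.

(** * Green correspondence *)

Section GreenCorrespondence.

Variables (K : fieldType) (gT : finGroupType).

Lemma reltr_sum (G H : {group gT}) (V : representation K G) (I : Type)
    (r : seq I) F :
  reltr H V (\sum_(i <- r) F i) = \sum_(i <- r) reltr H V (F i).
Proof.
elim: r => [|i r IH]; last by rewrite !big_cons reltrD IH.
rewrite !big_nil /reltr /csum big1 // => C _.
by rewrite /conj_mx mulmx0 mul0mx.
Qed.

(* Expand [1 = Tr_Q (be * Tr_R al)] by the double coset formula; a single
   term [Tr_(Q :&: R^x) (be * al^x)] is already invertible. *)
Lemma vertex_sub_conj (H Q R : {group gT}) (N : representation K H) :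
  indecomposable N -> vertex N Q -> rel_projective N R ->
  exists2 h, h \in H & Q \subset R :^ h.
Proof.
move=> indN [/rel_projectiveP[sQH [be [hbe trbe]]] minQ].
case/rel_projectiveP => sRH [al [hal tral]].
have hphi := conj_mx_linv hal.
have [s [sH trE]] := csum_Mackey sRH sQH hphi.
pose D x := (Q :&: R :^ x)%G; have sDQ x : D x \subset Q by apply: subsetIl.
have sDH x : D x \subset H := fintype.subset_trans (sDQ x) sQH.
pose ga x := be *m conj_mx N al x.
have hga x : x \in H -> hom (res_mod (sDH x) N) (res_mod (sDH x) N) (ga x).
  move=> Hx d /setIP[Qd]; rewrite mem_conjg conjgE invgK => Rd /=.
  have Hd := fintype.subsetP sQH d Qd; have /= hbd := hbe d Qd.
  have : N d *m conj_mx N al x = conj_mx N al x *m N d.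
    have <- := conj_mx_equivar (V := N) al Hx Hd.
    by rewrite -(hphi _ x Rd) // !mulgA mulgKV.
  rewrite /ga; move: (conj_mx N al x) => c cd.
  by rewrite mulmxA hbd -!mulmxA cd.
have {}trE : \sum_(x <- s) reltr (D x) N (ga x) = 1%:M.
  rewrite -trbe -[be in RHS]mulmx1 -tral /reltr trE mulmx_sumr -/(reltr Q N _).
  rewrite reltr_sum !big_seq; apply: eq_bigr => x sx; have Hx := sH x sx.
  apply: etrans (reltr_trans sQH (sDQ x) (hga x Hx)) _; congr (reltr _ _ _).
  rewrite /reltr /csum mulmx_sumr; apply: eq_bigr => C.
  case/(rcosets_repr (sDQ x)) => Qr _; move: (repr C) Qr => q Qq.
  have Hq := fintype.subsetP sQH q Qq.
  have Qq' := groupVr Qq; have /= hbq := hbe _ Qq'.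
  have Hx' := groupVr Hx; have Hq' := groupVr Hq.
  by rewrite /ga /conj_mx /= invMg !repr_mxM // !mulmxA hbq.
have [x /sH Hx||x /sH Hx trU] := local_unit_sum indN (r := s)
    (F := fun x => reltr (D x) N (ga x)).
- by apply: reltr_hom (hga x Hx).
- by rewrite trE unitmx1.
have := minQ _ (sDQ x) (rel_projective_unit (hga x Hx) trU).
by move=> DQ; exists x => //; rewrite -{1}DQ subsetIr.
Qed.

(** The identity of [N] is a sum over the cosets [H x]. The coset [H] contributes a composite
    [N -> L -> N]; if the others added up to a unit, Mackey's formula would force the vertex [Q]
    into a conjugate by an element outside [H]. *)
Lemma green_summand (G H Q : {group gT}) (sHG : H \subset G)
    (N L : representation K H) :
  (forall x, x \in G -> x \in 'N(Q) -> x \in H) ->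
  indecomposable N -> vertex N Q -> rel_projective L Q ->
  retract N (res_mod sHG (ind_mod L sHG)) -> retract N L.
Proof.
move=> NQH indN vN /rel_projectiveP[sQH [be [hbe trbe]]].
case/ind_components => a [b [aH bH aG bG ab1]].
have sQG := fintype.subset_trans sQH sHG.
have HG h : h \in H -> h \in G by apply: (fintype.subsetP sHG).
have QH q : q \in Q -> q \in H by apply: (fintype.subsetP sQH).
(* [theta] keeps the trivial coset; [psi] refines the remaining ones to cosets of [Q] by inserting
   [1 = Tr_Q be] on [L]. *)
pose theta x := if x \in H then a x *m b x else 0.
pose psi x := if x \in H then 0 else a x *m be *m b x.
have htheta : linv H G theta.
  move=> h x Hh Gx; rewrite /theta groupMl //; case: ifP => // Hx.
  by rewrite bH // mulmxA aH.
have hpsi : linv Q G psi.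
  move=> q x Qq Gx; rewrite /psi groupMl ?(QH q) //; case: ifP => // _.
  have /= hbq := hbe q Qq.
  rewrite bH ?(QH q) // -(aH q x) ?(QH q) // -!mulmxA; congr (_ *m _).
  by rewrite !mulmxA hbq.
have etheta : equivar (N := N) G theta.
  move=> x h Gx Hh; rewrite /theta groupMr //; case: ifP => _.
    by rewrite mulmxA aG // bG // mulmxA.
  by rewrite mulmx0 mul0mx.
have epsi : equivar (N := N) G psi.
  move=> x h Gx Hh; rewrite /psi groupMr //; case: ifP => _.
    by rewrite mulmx0 mul0mx.
  by rewrite !mulmxA aG // bG // mulmxA.
have split1 : csum H G theta + csum Q G psi = 1%:M.
  rewrite (csum_trans sQH sHG hpsi) -ab1 /csum -big_split /=.
  apply: eq_bigr => C /(rcosets_repr sHG)[]; move: (repr C) => x Gx _.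
  rewrite /theta /psi; case: ifP => Hx.
    rewrite [X in _ + X]big1 ?addr0 // => C'.
    by case/(rcosets_repr sQH) => Hr _; rewrite groupM.
  rewrite add0r -[b x in RHS]mul1mx -trbe /reltr /csum mulmx_suml mulmx_sumr.
  apply: eq_bigr => C' /(rcosets_repr sQH)[]; move: (repr C') => h Hh _.
  rewrite groupMl // Hx bH // /conj_mx -(aH h x) // !mulmxA.
  by rewrite -(mulmxA _ (L h) (L h^-1%g)) -repr_mxM ?groupV // mulgV repr_mx1
            mulmx1.
have : csum H G theta + csum Q G psi \in unitmx by rewrite split1 unitmx1.
case/(local_unitD indN).
- exact: csum_hom.
- exact: csum_hom.
- rewrite /csum -big_enum => /(local_unit_sum indN)[C|C].
    rewrite mem_enum => /(rcosets_repr sHG)[]; move: (repr C) => x Gx _ h Hh.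
    rewrite -etheta //; congr (_ *m _); rewrite /theta groupMr //.
    case: ifP => // Hx; have := htheta (x * h * x^-1)%g x.
    by rewrite !groupM ?groupV // mulgKV /theta groupMr // Hx => ->.
  rewrite mem_enum => /(rcosets_repr sHG)[]; move: (repr C) => x Gx _.
  rewrite /theta; case: ifP => [Hx U|]; last first.
    by have := @nil_nonunit _ _ _ _ indN 0 1%N (expr1 _); move/negPf->.
  have {U} : theta 1%g \in unitmx.
    by rewrite -(htheta x) // mulg1 /theta Hx.
  rewrite /theta group1 => U.
  have ha1 : hom N L (a 1%g).
    move=> h Hh; have := aG h^-1%g h; rewrite mulVg groupV => -> //.
      2: exact: HG.
    by rewrite -(aH h h^-1%g) ?groupV ?(HG h) // mulgV.
  have hb1 : hom L N (b 1%g).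
    by move=> h Hh; rewrite -(bH h 1%g) // mulg1 -bG // mul1g.
  exists (a 1%g), (b 1%g *m invmx (a 1%g *m b 1%g)); split=> //.
    exact: homM hb1 (hom_inv (homM ha1 hb1)).
  by rewrite mulmxA mulmxV.
(* [N] is now projective relative to [H :&: Q :^ x], so [Q] lies in [Q :^ (x h)] for some [h] in
   [H]. Then [x h] normalizes [Q], and [x] is in [H], where [psi] vanishes: the trace equation reads
   [0 = 1]. *)
move=> U.
have [x Gx [c [hc relN tr1]]] := mackey_local sQG sHG indN hpsi epsi U.
have [h Hh sQ] := vertex_sub_conj indN vN relN.
have sQxh : Q \subset Q :^ (x * h).
  apply: fintype.subset_trans sQ _; rewrite conjsgM conjSg; exact: subsetIr.
have Nxh : (x * h)%g \in 'N(Q).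
  have : Q :==: Q :^ (x * h) by rewrite eqEcard sQxh cardJg /=.
  by rewrite inE; move/eqP <-.
have Hx : x \in H by rewrite -(groupMr x Hh) NQH // groupM ?(HG h).
move: tr1; rewrite /psi Hx mul0mx => tr0.
have := @nil_nonunit _ _ _ _ indN 0 1%N (expr1 _).
have <- : 1%:M = 0 :> 'M[K]_(rdegree N).
  rewrite -tr0 /reltr /csum big1 // => C _.
  by rewrite /conj_mx mulmx0 mul0mx.
by rewrite unitmx1.
Qed.

End GreenCorrespondence.

(** * Base change *)

Lemma rel_projective_retract (K : fieldType) (gT : finGroupType)
    (G R : {group gT}) (U V : representation K G) :
  retract U V -> rel_projective V R -> rel_projective U R.
Proof.
move=> rUV [sRG [X /summandP rV]]; exists sRG, X; apply/summandP.
exact: retract_trans rUV rV.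
Qed.

Section BaseChange.

Variables (F E : fieldType) (f : {rmorphism F -> E}) (gT : finGroupType).

Lemma ext_ind_eq (G H : {group gT}) (U : representation F H) g :
  map_mx f (@ind_mx F gT G H U g) = @ind_mx E gT G H (ext_mod f U) g.
Proof.
apply/matrixP => i j; rewrite !mxE; by case: ifP; rewrite !mxE ?rmorph0.
Qed.

Lemma retract_ext_ind (G H : {group gT}) (sHG : H \subset G)
    (U : representation F H) :
  retract (ext_mod f (ind_mod U sHG)) (ind_mod (ext_mod f U) sHG).
Proof.
apply: (@retract_of_eq _ _ _ _ (map_repr f (ind_mod U sHG))
  (MxRepresentation (ind_mx_repr (ext_mod f U) sHG))) => g _.
exact: ext_ind_eq.
Qed.

Lemma retract_ind_ext (G H : {group gT}) (sHG : H \subset G)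
    (U : representation F H) :
  retract (ind_mod (ext_mod f U) sHG) (ext_mod f (ind_mod U sHG)).
Proof.
apply: (@retract_of_eq _ _ _ _
  (MxRepresentation (ind_mx_repr (ext_mod f U) sHG))
  (map_repr f (ind_mod U sHG))) => g _.
exact/esym/ext_ind_eq.
Qed.

Lemma ext_retract_ind (G H : {group gT}) (sHG : H \subset G)
    (V : representation F G) (U : representation F H) :
  retract V (ind_mod U sHG) ->
  retract (ext_mod f V) (ind_mod (ext_mod f U) sHG).
Proof. by move/(retract_ext f)/retract_trans; apply; apply: retract_ext_ind. Qed.

Lemma rel_projective_ext (G R : {group gT}) (V : representation F G) :
  rel_projective V R -> rel_projective (ext_mod f V) R.
Proof.
case=> sRG [X /summandP rV]; exists sRG, (ext_mod f X); apply/summandP.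
exact: ext_retract_ind.
Qed.

(** A trace-one endomorphism of [Y], composed with the splitting maps, makes [Y] a summand of the
    extension of [Ind_R^G Res_R W], to which [retract_descent] applies. *)
Lemma rel_projective_descent (G R : {group gT}) (W : representation F G)
    (Y : representation E G) :
  indecomposable W -> (0 < rdegree Y)%N -> retract Y (ext_mod f W) ->
  rel_projective Y R -> rel_projective W R.
Proof.
move=> indW Y0 rYW /rel_projectiveP[sRG [al [hal tr1]]].
exists sRG, (res_mod sRG W); apply/summandP.
apply: (retract_descent indW Y0 rYW).
apply: retract_trans (retract_ind_ext sRG (res_mod sRG W)).
case: rYW => A [B [hA hB AB]]; apply/ind_retractP.
exists (al *m A), B; split; last by rewrite -mulmxA AB mulmx1.
  apply: (@homM _ _ _ _ (res_mod sRG Y)) => // r Rr.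
  exact: hA (fintype.subsetP sRG r Rr).
by move=> r Rr; apply: hB (fintype.subsetP sRG r Rr).
Qed.

Lemma source_ext (G Q : {group gT}) (V : representation F G)
    (Y : representation E G) (SV : representation F Q)
    (SY : representation E Q) :
  indecomposable Y -> retract Y (ext_mod f V) ->
  vertex_source V SV -> vertex_source Y SY ->
  exists (h : gT) (Nh : h \in 'N(Q)),
    h \in 'N_G(Q) /\ summand (conj_mod SY Nh) (ext_mod f SV).
Proof.
move=> indY rYV [_ _ [sQG /summandP rV]] [vY indSY [sQG' /summandP rY]].
have rYS : retract Y (ind_mod (ext_mod f SV) sQG').
  apply: retract_trans rYV _; rewrite (bool_irrelevance sQG' sQG).
  exact: ext_retract_ind.
have [h [Nh [NGh r]]] := source_conj indY vY indSY rY rYS.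
by exists h, Nh; split=> //; apply/summandP.
Qed.

(* Both correspondents are found inside [L], a summand of [Ind_Q^N(Q)] of a
   module such that [V] is a summand of [Ind_N(Q)^G L]. *)
Lemma green_ext (G Q : {group gT}) (V : representation F G)
    (Y : representation E G) (GV : representation F 'N_G(Q))
    (GY : representation E 'N_G(Q)) :
  retract Y (ext_mod f V) -> Green V GV -> Green Y GY ->
  summand GY (ext_mod f GV).
Proof.
move=> rYV [indV vV indGV vGV /summandP rGV] [_ _ indGY vGY /summandP rGY].
pose H := 'N_G(Q)%G; have sHG : H \subset G := subsetIl G 'N(Q).
have [[sQG [U /summandP/ind_retractP[a [b [ha hb tr1]]]]] _] := vV.
have sQH : Q \subset H by rewrite finset.subsetI sQG normG.
(* Induction in stages, obtained from transitivity of the trace. *)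
have rV : retract V (ind_mod (ind_mod U sQH) sHG).
  apply/ind_retractP.
  exists (\mxrow_(j < #|H : Q|) (res_mod sHG V (transv j)^-1%g *m a)).
  exists (\mxcol_(i < #|H : Q|) (b *m res_mod sHG V (transv i))).
  split; [exact: hom_to_ind|exact: hom_of_ind|].
  have := ind_comp (V := res_mod sHG V) (H := Q) a b; rewrite /= => ->.
  rewrite -[RHS]tr1; apply/esym; apply: (reltr_trans sHG sQH (sQG := sQG)).
  exact: homM ha hb.
have [L [indL rL rVL]] := indec_ind_summand indV rV.
have relL : rel_projective L Q by exists sQH, U; apply/summandP.
have NH x : x \in G -> x \in 'N(Q) -> x \in H by move=> Gx Nx; rewrite inE Gx.
have res (K : fieldType) (V1 V2 : representation K G) :
    retract V1 V2 -> retract (res_mod sHG V1) (res_mod sHG V2).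
  case=> A [B [hA hB AB]]; exists A, B.
  by split=> // q Hq; [apply: hA|apply: hB]; apply: (fintype.subsetP sHG).
have GV_L : retract GV L.
  apply: (green_summand NH indGV vGV relL).
  exact: retract_trans rGV (res _ _ _ rVL).
have GY_L : retract GY (ext_mod f L).
  apply: (green_summand NH indGY vGY (rel_projective_ext relL)).
  apply: retract_trans rGY (res _ _ _ _).
  exact: retract_trans rYV (ext_retract_ind rVL).
apply/summandP; apply: retract_trans GY_L _; apply: retract_ext.
apply: iso_retract; apply: iso_mod_sym; apply: retract_indec_iso GV_L indL _.
by case: indGV.
Qed.

End BaseChange.

(** * Finite subfields of the algebraic closure *)

Section FrobeniusPower.

Variables (p : nat) (L : fieldType) (chL : p \in [pchar L]) (k : nat).

(** The proof of the characteristic is an argument so that the morphism structure can be attached to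
    [frobX chL]; likewise for [frob_fixed]. *)
Definition frobX of p \in [pchar L] := fun x : L => x ^+ (p ^ k).

Lemma frobX_zmod : zmod_morphism (frobX chL).
Proof.
rewrite /frobX; elim: k => [|n IH] x y; first by rewrite !expr1.
by rewrite expnSr !exprM IH -!(pFrobenius_autE chL) rmorphB.
Qed.

Lemma frobX_monoid : monoid_morphism (frobX chL).
Proof. by split=> [|x y]; rewrite /frobX ?expr1n ?exprMn. Qed.

HB.instance Definition _ :=
  GRing.isZmodMorphism.Build L L (frobX chL) frobX_zmod.
HB.instance Definition _ :=
  GRing.isMonoidMorphism.Build L L (frobX chL) frobX_monoid.

(** For [k > 0] and [L] algebraically closed this is the subfield with [p ^ k] elements; for [k = 0]
    it is all of [L], whence the conditions [0 < n] below. *)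
Definition frob_fixed of p \in [pchar L] : {pred L} :=
  fun x => x ^+ (p ^ k) == x.

Lemma frob_fixed_divring : divring_closed (frob_fixed chL).
Proof.
split=> [|x y|x y]; rewrite !unfold_in ?expr1n // => /eqP xE /eqP yE.
  by have := frobX_zmod x y; rewrite /frobX xE yE => ->.
by rewrite exprMn exprVn xE yE.
Qed.

HB.instance Definition _ :=
  GRing.isDivringClosed.Build L (frob_fixed chL) frob_fixed_divring.

End FrobeniusPower.

Section FiniteSubfields.

Variables (p : nat) (L : closedFieldType) (iota : {rmorphism 'F_p -> L}).
Hypothesis p_prime : prime p.

Lemma pchar_closure : p \in [pchar L].
Proof. by rewrite (fmorph_pchar iota) pchar_Fp. Qed.

Let chL := pchar_closure.

Lemma frob_fixed_finite n : (0 < n)%N ->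
  finite_set [set x : L | x \in frob_fixed n chL].
Proof.
move=> n_gt0; pose P : {poly L} := 'X^(p ^ n) - 'X.
have q_gt1 : (1 < p ^ n)%N by rewrite -{1}(expn0 p) ltn_exp2l ?prime_gt1.
have P_neq0 : P != 0.
  by rewrite -size_poly_eq0 size_polyDl ?size_polyXn // size_polyN size_polyX.
have [r PE] := closed_field_poly_normal P.
apply: (@sub_finite_set _ _ [set` r]); last exact: finite_seq.
move=> x /=; rewrite unfold_in => /eqP xE.
have : root P x by rewrite /root !hornerE xE subrr.
by rewrite PE rootZ ?lead_coef_eq0 // root_prod_XsubC.
Qed.

Lemma frob_fixed_mul n m x :
  x \in frob_fixed n chL -> x \in frob_fixed (n * m) chL.
Proof.
rewrite !unfold_in => /eqP xE; elim: m => [|m IH]; first by rewrite muln0 expr1.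
by rewrite mulnS expnD exprM xE.
Qed.

Lemma Fp_fermat (a : 'F_p) : a ^+ p = a.
Proof. by have := expf_card a; rewrite card_Fp. Qed.

(** The image of [iota] already supplies [p] roots of ['X^p - 'X]. *)
Lemma frob_fixed_prime x : x ^+ p = x -> exists a, iota a = x.
Proof.
move=> xE; apply: contrapT => no_a.
pose P : {poly L} := 'X^p - 'X.
have p_gt1 := prime_gt1 p_prime.
have sizeP : size P = p.+1.
  by rewrite size_polyDl ?size_polyXn // size_polyN size_polyX.
have := @max_poly_roots _ P (x :: [seq iota a | a : 'F_p]).
rewrite /= size_map -cardE card_Fp // sizeP ltnn -size_poly_eq0 sizeP => rt.
suff : false by []; apply: rt => //; last first.
  rewrite map_inj_uniq ?enum_uniq ?andbT; last exact: fmorph_inj.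
  by apply/negP => /mapP[a _ xa]; apply: no_a; exists a.
rewrite /root !hornerE xE subrr eqxx /=.
apply/allP => _ /mapP[a _ ->]; rewrite /root !hornerE -rmorphXn.
by rewrite Fp_fermat subrr.
Qed.

(** All Frobenius iterates of [x] are roots of one polynomial over ['F_p], so two of them coincide;
    Frobenius is injective, so some iterate fixes [x]. *)
Lemma frob_fixed_alg x : algebraicOver iota x ->
  exists2 n, (0 < n)%N & x \in frob_fixed n chL.
Proof.
case=> P P_neq0 Px.
have PX i : root (map_poly iota P) (x ^+ (p ^ i)).
  elim: i => [|i IH]; first by rewrite expr1.
  rewrite expnSr exprM -(pFrobenius_autE chL).
  have -> : map_poly iota P = map_poly (pFrobenius_aut chL) (map_poly iota P).
    rewrite -map_poly_comp; apply: eq_map_poly => a /=.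
    by rewrite pFrobenius_autE -rmorphXn Fp_fermat.
  by rewrite fmorph_root.
apply: contrapT => no_n.
have frob_inj i j : (i <= j)%N -> x ^+ (p ^ i) = x ^+ (p ^ j) -> i = j.
  move=> le_ij; rewrite -(subnK le_ij) expnD exprM.
  rewrite -[LHS]/(frobX i chL x) -[RHS]/(frobX i chL _) => /fmorph_inj xE.
  case d: (j - i)%N => [//|d']; case: no_n; exists d'.+1 => //.
  by rewrite unfold_in -d -xE.
have U : uniq (mkseq (fun i => x ^+ (p ^ i)) (size (map_poly iota P))).
  apply/mkseq_uniqP => i j _ _ eq_ij.
  by have [/frob_inj->|/ltnW/frob_inj->] := leqP i j.
have := @max_poly_roots _ (map_poly iota P) _ _ _ U.
rewrite map_poly_eq0 size_mkseq ltnn => absurd.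
by suff : false by []; apply: absurd => //; apply/allP => _ /mapP[i _ ->].
Qed.

Lemma frob_fixed_seq (s : seq L) :
  (forall x : L, algebraicOver iota x) ->
  exists2 n, (0 < n)%N & {subset s <= frob_fixed n chL}.
Proof.
move=> L_alg; elim: s => [|x s [n n0 sn]]; first by exists 1%N.
have [m m0 xm] := frob_fixed_alg (L_alg x).
exists (m * n)%N => [|y]; first by rewrite muln_gt0 m0.
rewrite inE => /predU1P[->|/sn yn]; first exact: frob_fixed_mul.
by rewrite mulnC; apply: frob_fixed_mul.
Qed.

(* [theta] is a generator of the multiplicative group of the field with
   [p ^ n] elements. *)
Lemma frob_generator n : (0 < n)%N ->
  exists2 theta : L, theta \in frob_fixed n chL &
    forall i j, (i < n)%N -> (j < n)%N ->
      theta ^+ (p ^ i) = theta ^+ (p ^ j) -> i = j.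
Proof.
move=> n_gt0; have p_gt1 := prime_gt1 p_prime.
have q_gt1 : (1 < p ^ n)%N by rewrite -{1}(expn0 p) ltn_exp2l.
pose m := (p ^ n).-1.
have mS : m.+1 = (p ^ n)%N by rewrite prednK // ltnW.
have m_gt0 : (0 < m)%N by rewrite -ltnS mS.
have [r rE] := closed_field_poly_normal ('X^m - 1 : {poly L}).
rewrite (monicP (monic_Xn_sub_1 L m_gt0)) scale1r in rE.
(* [m = p ^ n - 1] is [-1] in [L], which makes ['X^m - 1] separable. *)
have m_neq0 : m%:R != 0 :> L.
  have : m.+1%:R = 0 :> L.
    by rewrite mS natrX (pcharf0 chL) expr0n gtn_eqF.
  rewrite -natr1 => /eqP; rewrite addr_eq0 => /eqP->.
  by rewrite oppr_eq0 oner_eq0.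
have Ur : uniq r.
  by rewrite -separable_prod_XsubC -rE separable_Xn_sub_1.
have sz_r : size r = m.
  by have := size_Xn_sub_1 L m_gt0; rewrite rE size_prod_XsubC => -[].
have rts : all m.-unity_root r.
  apply/allP => x xr; rewrite unity_rootE -subr_eq0.
  have : root ('X^m - 1) x by rewrite rE root_prod_XsubC.
  by rewrite /root !hornerE.
have /hasP[th _ prim] : has m.-primitive_root r.
  by apply: has_prim_root => //; rewrite sz_r.
exists th; first by rewrite unfold_in -mS exprS prim_expr_order // mulr1.
wlog lt_ij : / forall i j, (i < j < n)%N -> th ^+ (p ^ i) != th ^+ (p ^ j).
  apply=> i j /andP[lt_ij lt_jn].
  (* [p ^ n >= 2 * p ^ j >= p ^ j + 2], the last because [j > 0]; so both exponents stay below the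
     order [m] of [th]. *)
  have le_j : (p ^ j < m)%N.
    rewrite -ltnS mS.
    have : (p ^ j.+1 <= p ^ n)%N by rewrite leq_exp2l.
    apply: leq_trans; rewrite expnS.
    have : (2 <= p ^ j)%N.
      apply: (leq_trans p_gt1); rewrite -{1}(expn1 p) leq_exp2l //.
      exact: leq_ltn_trans (leq0n i) lt_ij.
    move=> le2; apply: (@leq_trans (2 * p ^ j)%N).
      2: by rewrite leq_mul2r p_gt1 orbT.
    by rewrite mul2n -addnn -addn2 addnC leq_add2r.
  have lt_pij : (p ^ i < p ^ j)%N by rewrite ltn_exp2l.
  rewrite (eq_prim_root_expr prim) !modn_small //; last exact: ltn_trans lt_pij _.
  by rewrite ltn_eqF.
move=> i j lti ltj /eqP eq_ij; case: (ltngtP i j) => // lt.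
  by have := lt_ij i j; rewrite lt ltj eq_ij => /(_ isT).
by have := lt_ij j i; rewrite lt lti eq_sym eq_ij => /(_ isT).
Qed.

End FiniteSubfields.

(* [M] is the direct sum of the Frobenius twists of [Y], written in a basis in
   which the entries are fixed by Frobenius: [T] is the matrix of conjugates of
   [1, theta, ..., theta ^ n], and applying Frobenius to it permutes its rows
   cyclically. *)
Lemma prime_field_form (p : nat) (L : closedFieldType)
    (iota : {rmorphism 'F_p -> L}) (gT : finGroupType) (G : {group gT})
    (Y : representation L G) :
  prime p -> (forall x : L, algebraicOver iota x) ->
  exists M : representation 'F_p G, retract Y (ext_mod iota M).
Proof.
move=> p_prime L_alg; pose d := rdegree Y.
have chL : p \in [pchar L] := pchar_closure iota p_prime.
pose s := [seq Y g ij.1 ij.2 | g <- enum G, ij <- enum {: 'I_d * 'I_d}].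
have [n' + sn] := frob_fixed_seq p_prime s L_alg; case: n' sn => // n sn _.
have Yn g i j : g \in G -> Y g i j ^+ (p ^ n.+1) = Y g i j.
  move=> Gg; have : Y g i j \in s.
    apply/allpairsP; exists (g, (i, j)).
    by rewrite mem_enum; split=> //; rewrite mem_enum.
  by move/sn; rewrite unfold_in => /eqP.
have [th] := frob_generator iota p_prime (ltn0Sn n).
rewrite unfold_in => /eqP thn th_inj.
pose Yk (k : 'I_n.+1) g := map_mx (frobX k chL) (Y g).
pose T : 'M[L]_n.+1 := (Vandermonde n.+1 (\row_k th ^+ (p ^ k)))^T.
have TE k j : T k j = th ^+ (p ^ k) ^+ j by rewrite !mxE.
have TU : T \in unitmx.
  rewrite unitmx_tr unitmxE unitfE det_Vandermonde.
  apply/prodf_neq0 => i _; apply/prodf_neq0 => j lt_ij; rewrite !mxE subr_eq0.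
  by apply/eqP => /th_inj eq_ij; rewrite eq_ij ?ltnn // in lt_ij.
have [Ti TTi1 TiT1] : exists2 Ti, T *m Ti = 1%:M & Ti *m T = 1%:M.
  by exists (invmx T); rewrite ?mulmxV ?mulVmx.
pose sg := perm (@ordS_inj n.+1).
pose phi : {rmorphism L -> L} := frobX 1 chL.
have frobS k x : phi (frobX k chL x) = frobX k.+1 chL x.
  by rewrite /phi /= /frobX expn1 -exprM -expnSr.
(* When the index wraps from [n] to 0, the power [p ^ n.+1] fixes [th] and the entries of [Y]. *)
have ordS_val (k : 'I_n.+1) :
    (k.+1 %% n.+1 = k.+1 \/ k.+1 %% n.+1 = 0 /\ k = n :> nat)%N.
  have := ltn_ord k; rewrite ltnS leq_eqVlt => /predU1P[->|lt_kn].
    by right; rewrite modnn.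
  by left; rewrite modn_small.
have phiT : map_mx phi T = row_perm sg T.
  apply/matrixP => k j; rewrite !mxE permE rmorphXn /=; congr (_ ^+ _).
  rewrite -[th ^+ _]/(frobX k chL th) frobS /frobX /=.
  by case: (ordS_val k) => [->//|[-> ->]]; rewrite thn.
have phiTi : map_mx phi Ti = col_perm sg Ti.
  have phi1 : map_mx phi Ti *m row_perm sg T = 1%:M.
    by rewrite -phiT -map_mxM TiT1 map_mx1.
  rewrite -[LHS]mulmx1 -[RHS]mul1mx -[in RHS]phi1 -mulmxA; congr (_ *m _).
  rewrite row_permE col_permE mulmxA -(mulmxA _ T Ti) TTi1 mulmx1.
  by rewrite -perm_mxM mulgV perm_mx1.
have phiY (k : 'I_n.+1) g : g \in G -> map_mx phi (Yk k g) = Yk (ordS k) g.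
  move=> Gg; apply/matrixP => i j; rewrite !mxE frobS /frobX /=.
  by case: (ordS_val k) => [->//|[-> ->]]; rewrite Yn.
pose c k i j := Ti i k * T k j.
have c1 i j : \sum_k c k i j = (i == j)%:R.
  by have /matrixP/(_ i j)   := TiT1; rewrite !mxE.
have TTi k l : \sum_j T k j * Ti j l = (k == l)%:R.
  by have /matrixP/(_ k l) := TTi1; rewrite !mxE.
(* The blocks of [diag(Yk)] conjugated by the tensor product of [T] with an identity matrix. *)
pose B g i j := \sum_k c k i j *: Yk k g.
pose M g : 'M_(\sum_(i < n.+1) d) := \mxblock_(i, j) B g i j.
have phiB g i j : g \in G -> map_mx phi (B g i j) = B g i j.
  move=> Gg; rewrite map_mx_sum [RHS](reindex_inj (@ordS_inj n.+1)) /=.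
  apply: eq_bigr => k _; rewrite map_mxZ phiY //; congr (_ *: _).
  rewrite rmorphM /= /c; congr (_ * _).
    by have /matrixP/(_ i k) := phiTi; rewrite !mxE permE.
  by have /matrixP/(_ k j) := phiT; rewrite [LHS]mxE [RHS]mxE permE.
have phiM g : g \in G -> map_mx phi (M g) = M g.
  move=> Gg; apply/matrixP => i j; rewrite mxE [M g i j]mxE.
  by have /matrixP/(_ (order.tagnat.sig2 i) (order.tagnat.sig2 j)) :=
    phiB g (order.tagnat.sig1 i) (order.tagnat.sig1 j) Gg; rewrite mxE.
have M_repr : mx_repr G M.
  split=> [|g h Gg Gh].
    rewrite -mxdiagZ; apply: eq_mxblock => i j; rewrite /B /Yk.
    under eq_bigr do rewrite repr_mx1 map_mx1.
    rewrite -scaler_suml c1; case: (eqVneq i j) => _.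
      by rewrite scale1r conform_mx_id.
    by rewrite scale0r.
  rewrite /M mul_mxblock; apply: eq_mxblock => i j.
  have -> : B (g * h)%g i j = \sum_k c k i j *: (Yk k g *m Yk k h).
    by apply: eq_bigr => k _; rewrite /Yk repr_mxM // map_mxM.
  transitivity (\sum_k \sum_l (\sum_m c k i m * c l m j) *: (Yk k g *m Yk l h)).
    apply: eq_bigr => k _.
    rewrite (bigD1 k) //= [X in _ + X]big1 ?addr0 => [|l neq_lk].
      congr (_ *: _); transitivity (Ti i k * (\sum_m T k m * Ti m k) * T k j).
        by rewrite TTi eqxx mulr1.
      rewrite mulr_sumr mulr_suml; apply: eq_bigr => m _.
      by rewrite /c !mulrA.
    suff -> : \sum_m c k i m * c l m j = 0 by rewrite scale0r.
    transitivity (Ti i k * (\sum_m T k m * Ti m l) * T l j).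
      by rewrite mulr_sumr mulr_suml; apply: eq_bigr => m _; rewrite /c !mulrA.
    by rewrite TTi eq_sym (negPf neq_lk) mulr0 mul0r.
  under [RHS]eq_bigr => m _.
    rewrite mulmx_suml.
    under eq_bigr => k _ do rewrite mulmx_sumr.
    over.
  rewrite [RHS]exchange_big; apply: eq_bigr => k _ /=.
  rewrite [RHS]exchange_big; apply: eq_bigr => l _ /=.
  rewrite scaler_suml; apply: eq_bigr => m _.
  by rewrite -scalemxAl -scalemxAr scalerA.
(* Inverse of [iota]; the default 0 is never taken on Frobenius-fixed elements. *)
pose rt (x : L) : 'F_p := odflt 0 [pick a | iota a == x].
have rtK x : x ^+ p = x -> iota (rt x) = x.
  case/(frob_fixed_prime iota p_prime) => a ax; rewrite /rt.
  by case: pickP => [b /eqP//|/(_ a)]; rewrite ax eqxx.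
pose M0 g := map_mx rt (M g).
have M0E g : g \in G -> map_mx iota (M0 g) = M g.
  move=> Gg; apply/matrixP => i j; rewrite mxE [M0 g i j]mxE rtK //.
  by have /matrixP/(_ i j) := phiM g Gg; rewrite mxE /phi /= /frobX expn1.
have M0_repr : mx_repr G M0.
  split=> [|g h Gg Gh]; apply: (@map_mx_inj _ _ iota).
    by rewrite M0E ?group1 // map_mx1; case: M_repr.
  by rewrite map_mxM !M0E ?groupM //; case: M_repr => _ ->.
exists (Representation (MxRepresentation M0_repr)).
apply: (@retract_trans _ _ _ _ (Representation (MxRepresentation M_repr)));
  last first.
  apply: retract_of_eq => g Gg /=; exact/esym/M0E.
have Y0 g : Yk ord0 g = Y g.
  by apply/matrixP => i j; rewrite mxE /frobX expn0 expr1.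
(* [Y] is the twist of index 0: row 0 of [T] embeds it and column 0 of [Ti] projects to it. *)
exists (\mxrow_(j < n.+1) (T 0 j)%:M), (\mxcol_(i < n.+1) (Ti i 0)%:M).
split=> [g Gg /=|g Gg /=|].
- rewrite mul_mxrow mul_mxrow_mxblock; apply: eq_mxrow => j.
  under eq_bigr do rewrite mul_scalar_mx scaler_sumr.
  rewrite exchange_big (bigD1 ord0) //= [X in _ + X]big1 ?addr0 => [|k neq_k0].
    under eq_bigr do rewrite scalerA /c mulrA.
    by rewrite -scaler_suml -mulr_suml TTi eqxx mul1r mul_mx_scalar Y0.
  under eq_bigr do rewrite scalerA /c mulrA.
  by rewrite -scaler_suml -mulr_suml TTi eq_sym (negPf neq_k0) mul0r scale0r.
- rewrite mxcol_mul mul_mxblock_mxrow; apply: eq_mxcol => i.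
  under eq_bigr do rewrite mul_mx_scalar scaler_sumr.
  rewrite exchange_big (bigD1 ord0) //= [X in _ + X]big1 ?addr0 => [|k neq_k0].
    under eq_bigr do rewrite scalerA mulrC /c -mulrA.
    by rewrite -scaler_suml -mulr_sumr TTi eqxx mulr1 mul_scalar_mx Y0.
  under eq_bigr do rewrite scalerA mulrC /c -mulrA.
  by rewrite -scaler_suml -mulr_sumr TTi (negPf neq_k0) mulr0 scale0r.
rewrite mul_mxrow_mxcol; under eq_bigr do rewrite -scalar_mxM.
by rewrite -raddf_sum TTi eqxx.
Qed.

(** * The map Gamma *)

Section ExtSummand.

Variables (F E : fieldType) (f : {rmorphism F -> E}).
Variables (gT : finGroupType) (G : {group gT}).

(** A splitting of [X] writes the identity of [Y] as a sum of endomorphisms through the two parts,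
    one of which is a unit. *)
Lemma indec_ext_summand (X : representation F G) (Y : representation E G) :
  indecomposable Y -> retract Y (ext_mod f X) ->
  exists L, [/\ indecomposable L, retract L X & retract Y (ext_mod f L)].
Proof.
move=> indY.
apply: (indec_summand_such (P := fun X => retract Y (ext_mod f X))).
  by move=> {}X /retract_deg; apply: leq_trans; case: indY.
move=> {}X U V /iso_dadd_split[p1 [i1 [p2 [i2 [hp1 hi1 hp2 hi2 pi1]]]]].
case=> A [B [hA hB AB]].
have part (Z : representation F G) (p : 'M_(rdegree X, rdegree Z)) i :
    hom X Z p -> hom Z X i ->
    A *m map_mx f p *m (map_mx f i *m B) \in unitmx -> retract Y (ext_mod f Z).
  move=> hp hi uU; have hAp := homM hA (hom_ext f hp).
  have hiB := homM (hom_ext f hi) hB.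
  pose u := invmx (A *m map_mx f p *m (map_mx f i *m B)).
  have hu : hom Y Y u := hom_inv (homM hAp hiB).
  exists (A *m map_mx f p), (map_mx f i *m B *m u); split=> //.
    exact: homM hiB hu.
  by rewrite mulmxA; apply: mulmxV uU.
have : A *m map_mx f p1 *m (map_mx f i1 *m B)
     + A *m map_mx f p2 *m (map_mx f i2 *m B) \in unitmx.
  rewrite -2!(mulmxA A) -mulmxDr 2!mulmxA -mulmxDl -!map_mxM -map_mxD pi1.
  by rewrite map_mx1 mul1mx AB unitmx1.
case/(local_unitD indY).
- exact: homM (homM hA (hom_ext f hp1)) (homM (hom_ext f hi1) hB).
- exact: homM (homM hA (hom_ext f hp2)) (homM (hom_ext f hi2) hB).
- by move=> U1; left; apply: part U1.
by move=> U2; right; apply: part U2.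
Qed.

Lemma indec_summand_exists (X : representation F G) :
  (0 < rdegree X)%N -> exists2 L, indecomposable L & retract L X.
Proof.
move=> X0; have [|||L [indL rL _]] :=
  @indec_summand_such F gT G (fun X => 0 < rdegree X)%N X; last by exists L.
- by [].
- move=> X' U V /mxrank_rsim /= ->; rewrite addn_gt0 => /orP[]; by [left|right].
exact: X0.
Qed.

Lemma iso_ext (U V : representation F G) :
  iso_mod U V -> iso_mod (ext_mod f U) (ext_mod f V).
Proof. exact: mx_rsim_map. Qed.

Lemma indecomposable_of_ext (V : representation F G) :
  indecomposable (ext_mod f V) -> indecomposable V.
Proof.
case=> V0 indV; split=> // U U' isoV.
apply: (indV (ext_mod f U) (ext_mod f U')).
apply: iso_mod_trans (iso_ext isoV) _.
apply: (@iso_of_eq _ _ _ _ (map_repr f (dadd_grepr U U'))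
          (dadd_grepr (ext_mod f U) (ext_mod f U'))) => g _ /=.
by rewrite /map_repr_mx /= map_block_mx !map_mx0.
Qed.

Lemma indecomposable_iso (U V : representation F G) :
  iso_mod U V -> indecomposable U -> indecomposable V.
Proof.
move=> isoUV [U0 indU]; split; first by rewrite -(mxrank_rsim isoUV).
by move=> X X' isoV; apply: indU; apply: iso_mod_trans isoV.
Qed.

Lemma is_ITI_rep (S : set (representation F G)) V :
  is_ITI S -> indecomposable V -> exists2 U, S U & iso_mod V U.
Proof. by case=> _ repS /repS[U [[SU isoU] _]]; exists U. Qed.

Lemma is_ITI_eq (S : set (representation F G)) U V :
  is_ITI S -> S U -> S V -> iso_mod U V -> U = V.
Proof.
case=> indS repS SU SV isoUV; have [Z [_ uniqZ]] := repS U (indS U SU).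
by rewrite -(uniqZ U) ?(uniqZ V) //; split=> //; apply: mx_rsim_refl.
Qed.

End ExtSummand.

Section GammaGraph.

Variables (p : nat) (p_prime : prime p) (L : closedFieldType).
Variables (iota : {rmorphism 'F_p -> L}).
Hypothesis L_alg : forall x : L, algebraicOver iota x.
Variables (gT : finGroupType) (G : {group gT}).
Variables (ITI : forall K : fieldType, set (representation K G)).
Hypothesis ITIP : forall K : fieldType, is_ITI (@ITI K).
Implicit Types (Y : representation L G) (W : representation 'F_p G).

Lemma ext_tower (K : divringClosed L) W :
  retract (ext_mod (sub_incl K) (ext_mod (prime_incl K iota) W))
          (ext_mod iota W).
Proof. by apply: retract_of_eq => g _; apply/matrixP => i j; rewrite !mxE. Qed.

Lemma retract_of_calE (K : divringClosed L) V W :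
  calE iota ITI W V -> retract (ext_mod (sub_incl K) V) (ext_mod iota W).
Proof.
case=> _ _ /summandP/(retract_ext (sub_incl K)) rVW.
exact: retract_trans rVW (ext_tower K W).
Qed.

Lemma retract_of_Gamma Y W : Gamma iota ITI Y W -> retract Y (ext_mod iota W).
Proof.
case=> K [V [/retract_of_calE rVW /iso_mod_sym/iso_retract rYV]].
exact: retract_trans rYV rVW.
Qed.

(* The splitting maps and the action on [Y] involve finitely many elements of
   [L], which lie in a common finite subfield. *)
Lemma Gamma_of_retract Y W :
  indecomposable Y -> retract Y (ext_mod iota W) -> Gamma iota ITI Y W.
Proof.
move=> indY [A [B [hA hB AB]]]; pose d := rdegree Y; pose m := rdegree W.
pose chL := pchar_closure iota p_prime.
pose s := [seq Y g ij.1 ij.2 | g <- enum G, ij <- enum {: 'I_d * 'I_d}]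
  ++ [seq A ij.1 ij.2 | ij <- enum {: 'I_d * 'I_m}]
  ++ [seq B ij.1 ij.2 | ij <- enum {: 'I_m * 'I_d}].
have [n n_gt0 sn] := frob_fixed_seq p_prime s L_alg.
pose K : divringClosed L := frob_fixed n chL.
(* The default 0 is never taken on entries that lie in [K], as all those of [Y], [A] and [B] do. *)
pose down k l (M : 'M[L]_(k, l)) : 'M[sub_field K]_(k, l) :=
  map_mx (insubd (0 : sub_field K)) M.
have downK k l (M : 'M[L]_(k, l)) :
    (forall i j, M i j \in K) -> map_mx (sub_incl K) (down k l M) = M.
  by move=> KM; apply/matrixP => i j; rewrite !mxE; apply: insubdK; apply: KM.
have YK g : g \in G -> map_mx (sub_incl K) (down _ _ (Y g)) = Y g.
  move=> Gg; apply: downK => i j; apply: sn; rewrite mem_cat; apply/orP; left.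
  apply/allpairsP; exists (g, (i, j)); rewrite mem_enum.
  by split; rewrite ?mem_enum.
have AK : map_mx (sub_incl K) (down _ _ A) = A.
  apply: downK => i j; apply: sn; rewrite !mem_cat; apply/or3P/Or32.
  by apply/mapP; exists (i, j); rewrite ?mem_enum.
have BK : map_mx (sub_incl K) (down _ _ B) = B.
  apply: downK => i j; apply: sn; rewrite !mem_cat; apply/or3P/Or33.
  by apply/mapP; exists (i, j); rewrite ?mem_enum.
have V0_repr : mx_repr G (fun g => down _ _ (Y g)).
  split=> [|g h Gg Gh]; apply: (@map_mx_inj _ _ (sub_incl K)).
    by rewrite YK ?group1 // repr_mx1 map_mx1.
  by rewrite map_mxM !YK ?groupM // repr_mxM.
pose V0 := Representation (MxRepresentation V0_repr).
have isoY : iso_mod (ext_mod (sub_incl K) V0) Y.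
  by case: Y indY A B hA hB AB d s sn down downK YK AK BK V0_repr @V0 => d Y *;
     apply: iso_of_eq.
have indV0 : indecomposable V0.
  exact: indecomposable_of_ext (indecomposable_iso (iso_mod_sym isoY) indY).
have [V SV isoV] := is_ITI_rep (@ITIP (sub_field K)) indV0.
exists K, V; split; last first.
  exact: iso_mod_trans (iso_ext (sub_incl K) (iso_mod_sym isoV)) isoY.
split=> //; first exact: frob_fixed_finite.
apply/summandP; apply: retract_trans (iso_retract (iso_mod_sym isoV)) _.
have WK g : map_mx (sub_incl K) (map_mx (prime_incl K iota) (W g)) =
    map_mx iota (W g).
  by apply/matrixP => i j; rewrite !mxE.
exists (down _ _ A), (down _ _ B); split=> [g Gg|g Gg|].
- by apply: (@map_mx_inj _ _ (sub_incl K)); rewrite !map_mxM YK // AK WK hA.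
- by apply: (@map_mx_inj _ _ (sub_incl K)); rewrite !map_mxM YK // BK WK hB.
by apply: (@map_mx_inj _ _ (sub_incl K)); rewrite map_mxM AK BK AB map_mx1.
Qed.

End GammaGraph.

Theorem theorem6 (p : nat) (p_prime : prime p)
    (Fbar : closedFieldType) (iota : {rmorphism 'F_p -> Fbar})
    (Fbar_alg : forall x : Fbar, algebraicOver iota x)
    (gT : finGroupType) (G : {group gT})
    (ITI : forall K : fieldType, set (representation K G))
    (ITIP : forall K : fieldType, is_ITI (ITI K)) :
  [/\ (* (a), well-definedness *)
      forall Y : representation Fbar G, ITI Fbar Y ->
        exists! W : representation 'F_p G, ITI 'F_p W /\ Gamma iota ITI Y W,
      (* (a), vertices, sources and Green correspondents *)
      forall (Y : representation Fbar G) (W : representation 'F_p G)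
          (K : divringClosed Fbar) (V : representation (sub_field K) G)
          (Q : {group gT}),
        ITI Fbar Y -> ITI 'F_p W -> Gamma iota ITI Y W ->
        calE iota ITI W V -> iso_mod (ext_mod (sub_incl K) V) Y ->
        vertex W Q ->
        [/\ vertex V Q, vertex Y Q,
            forall (SV : representation (sub_field K) Q)
                (SY : representation Fbar Q),
              vertex_source V SV -> vertex_source Y SY ->
              exists (h : gT) (Nh : h \in 'N(Q)),
                h \in 'N_G(Q) /\
                summand (conj_mod SY Nh) (ext_mod (sub_incl K) SV)
          & forall (GV : representation (sub_field K) 'N_G(Q))
                (GY : representation Fbar 'N_G(Q)),
              Green V GV -> Green Y GY ->
              summand GY (ext_mod (sub_incl K) GV)],
      (* (b) *)
      forall W : representation 'F_p G, ITI 'F_p W ->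
        Gamma_fibre iota ITI W !=set0
    & (* (c) *)
      partition (ITI 'F_p) (Gamma_fibre iota ITI) (ITI Fbar)].
Proof.
have indL Y : ITI Fbar Y -> indecomposable Y by case: (ITIP Fbar) => h _ /h.
have indF W : ITI 'F_p W -> indecomposable W by case: (ITIP 'F_p) => h _ /h.
have G_retract Y W : Gamma iota ITI Y W -> retract Y (ext_mod iota W).
  exact: retract_of_Gamma.
have exW Y : ITI Fbar Y -> exists2 W, ITI 'F_p W & Gamma iota ITI Y W.
  move=> SY; have [M rYM] := prime_field_form Y p_prime Fbar_alg.
  have [W0 [indW0 _ rYW0]] := indec_ext_summand (indL Y SY) rYM.
  have [W SW isoW] := is_ITI_rep (ITIP 'F_p) indW0.
  exists W => //; apply: Gamma_of_retract => //; first exact: indL.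
  exact: retract_trans rYW0 (iso_retract (iso_ext iota isoW)).
have uniqW Y W W' : ITI Fbar Y -> ITI 'F_p W -> ITI 'F_p W' ->
    Gamma iota ITI Y W -> Gamma iota ITI Y W' -> W = W'.
  move=> SY SW SW' /G_retract rW /G_retract rW'.
  have [[Y0 _] [W0 _]] := (indL Y SY, indF W SW).
  (* The common summand [Y] makes [W] divide [W']; both are indecomposable, hence isomorphic, hence
     the same representative. *)
  have r := retract_descent (indF W SW) Y0 rW rW'.
  exact: is_ITI_eq (ITIP 'F_p) SW SW' (retract_indec_iso r (indF W' SW') W0).
have fibre W : ITI 'F_p W -> Gamma_fibre iota ITI W !=set0.
  move=> SW; have [W0 _] := indF W SW.
  have [Y0 indY0 rY0] := @indec_summand_exists _ _ _ (ext_mod iota W) W0.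
  have [Y SY isoY] := is_ITI_rep (ITIP Fbar) indY0.
  exists Y; split=> //; apply: Gamma_of_retract => //; first exact: indL.
  exact: retract_trans (iso_retract (iso_mod_sym isoY)) rY0.
split=> //.
- move=> Y SY; have [W SW YW] := exW Y SY; exists W; split=> //.
  by move=> W' [SW' YW']; apply: uniqW YW YW'.
- move=> Y W K V Q SY SW /G_retract rYW VW isoY [relWQ minQ].
  have [indY indW] := (indL Y SY, indF W SW); have [Y0 _] := indY.
  have rYV := iso_retract (iso_mod_sym isoY).
  have [_ _ /summandP rVW] := VW.
  (* Relative projectivity passes from [W] to [V] to [Y] by extension and back to [W] by descent, so
     the three modules have the same vertices. *)
  have relV R : rel_projective W R -> rel_projective V R.
    move=> /(rel_projective_ext (prime_incl K iota)).
    exact: rel_projective_retract rVW.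
  have relY R : rel_projective V R -> rel_projective Y R.
    by move=> /(rel_projective_ext (sub_incl K)); apply: rel_projective_retract.
  have relW R : rel_projective Y R -> rel_projective W R.
    exact: rel_projective_descent indW Y0 rYW.
  split.
  + by split=> [|R sRQ /relY/relW/minQ]; [apply: relV|apply].
  + by split=> [|R sRQ /relW/minQ]; [apply/relY/relV|apply].
  + by move=> SV SrcY vSV vSY; apply: source_ext rYV vSV vSY.
  by move=> GV GY; apply: green_ext.
split=> //.
- apply/seteqP; split=> [Y [W _ []]//|Y SY].
  by have [W SW YW] := exW Y SY; exists W.
by move=> W W' SW SW' [Y [[SY YW] [_ YW']]]; apply: uniqW YW YW'.
Qed.
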